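(* Let $\mathcal{P}\subset\mathbb{Z}$ be the set of prime numbers. For every $0<\alpha<1$, $\mathcal{P}$ is $S_\alpha$-massive, where $S_\alpha$ is the $\alpha$-stable random walk on $\mathbb{Z}$.
   Context: Let $S$ be the symmetric simple random walk on $\mathbb{Z}$, with transition operator $P$. For $0<\alpha<1$, the $\alpha$-stable random walk $S_\alpha$ is the (transient) random walk on $\mathbb{Z}$ with transition operator $P_\alpha=I-(I-P)^{\alpha/2}=\sum_{k\geq1}c_kP^k$, where $c_k=(-1)^{k+1}\binom{\alpha/2}{k}\geq0$. A set $B\subset\mathbb{Z}$ is called $S_\alpha$-massive if for every starting point $x\in\mathbb{Z}$ the walk $S_\alpha$ started at $x$ hits $B$ with probability $1$. *)

(* Defs.v *)
From Stdlib Require Import Reals ZArith Znumtheory.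
From Coquelicot Require Import Coquelicot.
Open Scope R_scope.

Fixpoint Pk (k : nat) (x y : Z) : R :=
  match k with
  | O => if Z.eq_dec x y then 1 else 0
  | S k' => / 2 * Pk k' (x - 1)%Z y + / 2 * Pk k' (x + 1)%Z y
  end.

Fixpoint gbinom (a : R) (k : nat) : R :=
  match k with
  | O => 1
  | S k' => gbinom a k' * (a - INR k') / INR (S k')
  end.

Definition ck (alpha : R) (k : nat) : R :=
  (-1) ^ (S k) * gbinom (alpha / 2) k.

Definition P_alpha (alpha : R) (x y : Z) : R :=
  Series (fun n => ck alpha (S n) * Pk (S n) x y).

Definition sumZ (f : Z -> R) : R :=
  Series (fun n => f (Z.of_nat n)) + Series (fun n => f (- Z.of_nat n - 1)%Z).

(* hit p B n x = probability that the Markov chain with transition kernel p,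
   started at x, visits B at some time 0 <= m <= n (first-step analysis). *)
Fixpoint hit (p : Z -> Z -> R) (B : Z -> bool) (n : nat) (x : Z) : R :=
  match n with
  | O => if B x then 1 else 0
  | S n' => if B x then 1 else sumZ (fun y => p x y * hit p B n' y)
  end.

(* B is massive for the chain p: from every start the hitting probability
   P_x(tau_B < oo) = lim_n P_x(tau_B <= n) equals 1. *)
Definition massive (p : Z -> Z -> R) (B : Z -> bool) : Prop :=
  forall x : Z, is_lim_seq (fun n => hit p B n x) 1.

Definition primeb (z : Z) : bool :=
  if prime_dec z then true else false.

(* Main.v *)
Require Import Defs.
From Stdlib Require Import Reals ZArith Znumtheory.
From Stdlib Require Import Lra Lia ClassicalEpsilon Classical.
From Coquelicot Require Import Coquelicot.
Open Scope R_scope.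

(** With [s = alpha / 2], the Green function [g] of the walk is the kernel of
    [(I - P)^(-s) = sum_k a_k P^k], [a_k = s (s+1) ... (s+k-1) / k!]. It satisfies the
    first-order recurrence [(z + 1 - s) g (z + 1) = (z + s) g z], which by
    telescoping gives all the estimates of [g] that a power law
    [|z|^(alpha - 1)] would give. If the reciprocals of [B] have infinite sum,
    put the weights [1 / (b g b)] on the points [b] of [B] in [[L, M]]. Their
    potential is at least [Lambda / 4] at a starting point [x] with [|x| <= L],
    and at most [C + 4 Lambda] on [B], where [Lambda] is the sum of the [1 / b].
    By the maximum principle the hitting probability is at least
    [(Lambda / 4) / (C + 4 Lambda)], hence, for large [Lambda], at least [1/32]
    from every starting point. A hitting probability that is bounded below
    uniformly in the starting point equals [1]. The primes qualify by Euler's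
    theorem that the sum of their reciprocals diverges. *)

(** * Series and sums over the integers *)

Lemma sum_le_series (f : nat -> R) (l : R) (N : nat) :
  (forall n, 0 <= f n) -> is_series f l -> sum_f_R0 f N <= l.
Proof.
  intros Hf Hl.
  apply is_series_Reals in Hl.
  now apply sum_incr.
Qed.

Lemma is_series_lim (f : nat -> R) (l : R) :
  is_series f l <-> is_lim_seq (fun N => sum_f_R0 f N) l.
Proof.
  rewrite is_series_Reals, is_lim_seq_Reals. reflexivity.
Qed.

Lemma series_bounded (f : nat -> R) (M : R) :
  (forall n, 0 <= f n) -> (forall N, sum_f_R0 f N <= M) ->
  exists l, is_series f l /\ l <= M.
Proof.
  intros Hf HM.
  destruct (ex_finite_lim_seq_incr (fun N => sum_f_R0 f N) M) as [l Hl].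
  - intros n; simpl. pose proof (Hf (S n)); lra.
  - exact HM.
  - exists l; split.
    + now apply is_series_lim.
    + apply (is_lim_seq_le (fun N => sum_f_R0 f N) (fun _ => M) l M); auto.
      apply is_lim_seq_const.
Qed.

Lemma is_series_le (f g : nat -> R) (lf lg : R) :
  (forall n, f n <= g n) -> is_series f lf -> is_series g lg -> lf <= lg.
Proof.
  intros H Hf Hg. apply is_series_lim in Hf, Hg.
  apply (is_lim_seq_le (fun N => sum_f_R0 f N) (fun N => sum_f_R0 g N) lf lg); auto.
  intros N. apply sum_Rle. intros; auto.
Qed.

Lemma is_series_nonneg (f : nat -> R) (l : R) :
  (forall n, 0 <= f n) -> is_series f l -> 0 <= l.
Proof.
  intros Hf Hl. eapply Rle_trans; [apply (cond_pos_sum f 0 Hf)|]. now apply sum_le_series.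
Qed.

Lemma is_series_eq (f : nat -> R) (l l' : R) :
  is_series f l -> is_series f l' -> l = l'.
Proof. intros H H'. apply is_series_unique in H, H'. congruence. Qed.

Lemma is_series_cmult (c : R) (f : nat -> R) (l : R) :
  is_series f l -> is_series (fun n => c * f n) (c * l).
Proof.
  intros H. apply is_series_lim in H. apply is_series_lim.
  apply is_lim_seq_ext with (fun N => c * sum_f_R0 f N).
  - intros N. rewrite scal_sum. apply sum_eq. intros; ring.
  - now apply (is_lim_seq_scal_l (fun N => sum_f_R0 f N) c l).
Qed.

(* [is_series_ext] states its hypothesis in an abstract carrier, where [ring] fails. *)
Lemma is_series_congr (f g : nat -> R) (l : R) :
  (forall n, f n = g n) -> is_series f l -> is_series g l.
Proof. apply (@is_series_ext R_AbsRing R_NormedModule). Qed.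

Lemma is_series_add (f g : nat -> R) (a b : R) :
  is_series f a -> is_series g b -> is_series (fun n => f n + g n) (a + b).
Proof. apply (@is_series_plus R_AbsRing R_NormedModule). Qed.

Lemma is_series_sub (f g : nat -> R) (a b : R) :
  is_series f a -> is_series g b -> is_series (fun n => f n - g n) (a - b).
Proof. apply (@is_series_minus R_AbsRing R_NormedModule). Qed.

Lemma series_dominated (f g : nat -> R) (M lg : R) :
  (forall n, 0 <= f n <= M * g n) -> is_series g lg -> exists l, is_series f l.
Proof.
  intros Hfg Hg.
  assert (ex_series f) as [l Hl]; [|now exists l].
  apply (@ex_series_le R_AbsRing R_CompleteNormedModule f (fun n => M * g n)).
  - intros n. unfold norm; simpl. unfold abs; simpl.
    rewrite Rabs_pos_eq; apply Hfg.
  - exists (M * lg). now apply is_series_cmult.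
Qed.

Lemma is_series_finite_sum (A : nat -> nat -> R) (c : nat -> R) (K : nat) :
  (forall k, is_series (fun n => A n k) (c k)) ->
  is_series (fun n => sum_f_R0 (A n) K) (sum_f_R0 c K).
Proof.
  intros H; induction K as [|K IH]; simpl; [apply H|].
  now apply (is_series_add (fun n => sum_f_R0 (A n) K) (fun n => A n (S K))).
Qed.

(** Each entry is at most its row sum, so every column converges, and a finite sum of columns stays
    below [S] because finitely many columns can be added row by row. Applying this to the transpose
    as well gives the equality in [tonelli]. *)
Lemma tonelli_le (A : nat -> nat -> R) (r : nat -> R) (S : R) :
  (forall n k, 0 <= A n k) -> (forall n, is_series (A n) (r n)) -> is_series r S ->
  exists c T, (forall k, is_series (fun n => A n k) (c k)) /\ is_series c T /\ T <= S.
Proof.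
  intros HA Hr HS.
  assert (Hc : forall k, exists l, is_series (fun n => A n k) l).
  { intros k. apply (series_dominated _ r 1 S); auto.
    intros n; split; auto. rewrite Rmult_1_l.
    eapply Rle_trans; [|apply (sum_le_series (A n) (r n) k); auto].
    destruct k; simpl; [lra|]. pose proof (cond_pos_sum (A n) k (HA n)); lra. }
  exists (fun k => Series (fun n => A n k)).
  assert (Hc' : forall k, is_series (fun n => A n k) (Series (fun n => A n k))).
  { intros k; destruct (Hc k) as [l Hl]. now rewrite (is_series_unique _ _ Hl). }
  destruct (series_bounded (fun k => Series (fun n => A n k)) S) as [T [HT HTS]].
  - intros k. eapply is_series_nonneg; [|apply Hc']. intros n; apply HA.
  - intros K. eapply is_series_le; [|apply (is_series_finite_sum A _ K Hc')|apply HS].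
    intros n. apply sum_le_series; auto.
  - now exists T.
Qed.

Lemma tonelli (A : nat -> nat -> R) (r : nat -> R) (S : R) :
  (forall n k, 0 <= A n k) -> (forall n, is_series (A n) (r n)) -> is_series r S ->
  exists c, (forall k, is_series (fun n => A n k) (c k)) /\ is_series c S.
Proof.
  intros HA Hr HS.
  destruct (tonelli_le A r S HA Hr HS) as (c & T & Hc & HT & HTS).
  destruct (tonelli_le (fun k n => A n k) c T) as (r' & S' & Hr' & HS' & HST); auto.
  exists c; split; auto.
  replace S with T; auto.
  assert (S = S'); [|lra].
  apply (is_series_eq r); auto.
  apply is_series_ext with r'; auto.
  intros n. apply (is_series_eq (A n)); auto.
Qed.

(** [Series] returns a value even for a divergent series, so the relation records the convergence of
    both halves of [sumZ]. *)
Definition is_sumZ (f : Z -> R) (l : R) : Prop :=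
  exists l1 l2, is_series (fun n => f (Z.of_nat n)) l1 /\
    is_series (fun n => f (- Z.of_nat n - 1)%Z) l2 /\ l = l1 + l2.

Lemma is_sumZ_unique (f : Z -> R) (l : R) : is_sumZ f l -> sumZ f = l.
Proof.
  intros (l1 & l2 & H1 & H2 & ->). unfold sumZ.
  now rewrite (is_series_unique _ _ H1), (is_series_unique _ _ H2).
Qed.

Lemma is_sumZ_ext (f g : Z -> R) (l : R) :
  (forall y, f y = g y) -> is_sumZ f l -> is_sumZ g l.
Proof.
  intros H (l1 & l2 & H1 & H2 & ->). exists l1, l2; repeat split;
  (eapply is_series_ext; [|eassumption]; intros; apply H).
Qed.

Lemma is_sumZ_plus (f g : Z -> R) (a b : R) :
  is_sumZ f a -> is_sumZ g b -> is_sumZ (fun y => f y + g y) (a + b).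
Proof.
  intros (l1 & l2 & H1 & H2 & ->) (m1 & m2 & H3 & H4 & ->).
  exists (l1 + m1), (l2 + m2); repeat split.
  - now apply (is_series_add (fun n => f (Z.of_nat n)) (fun n => g (Z.of_nat n))).
  - now apply (is_series_add (fun n => f (- Z.of_nat n - 1)%Z) (fun n => g (- Z.of_nat n - 1)%Z)).
  - ring.
Qed.

Lemma is_sumZ_scal (f : Z -> R) (c a : R) :
  is_sumZ f a -> is_sumZ (fun y => c * f y) (c * a).
Proof.
  intros (l1 & l2 & H1 & H2 & ->).
  exists (c * l1), (c * l2); repeat split.
  - now apply (is_series_cmult c (fun n => f (Z.of_nat n))).
  - now apply (is_series_cmult c (fun n => f (- Z.of_nat n - 1)%Z)).
  - ring.
Qed.

Lemma is_sumZ_minus (f g : Z -> R) (a b : R) :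
  is_sumZ f a -> is_sumZ g b -> is_sumZ (fun y => f y - g y) (a - b).
Proof.
  intros Hf Hg. apply (is_sumZ_scal g (-1)) in Hg.
  replace (a - b) with (a + -1 * b) by ring.
  eapply is_sumZ_ext; [|apply (is_sumZ_plus _ _ _ _ Hf Hg)]. intros; simpl; ring.
Qed.

Lemma is_sumZ_le (f g : Z -> R) (a b : R) :
  (forall y, f y <= g y) -> is_sumZ f a -> is_sumZ g b -> a <= b.
Proof.
  intros H (l1 & l2 & H1 & H2 & ->) (m1 & m2 & H3 & H4 & ->).
  apply Rplus_le_compat; eapply is_series_le; try eassumption; intros; apply H.
Qed.

Lemma is_sumZ_dominated (f g : Z -> R) (M lg : R) :
  (forall y, 0 <= f y <= M * g y) -> is_sumZ g lg -> exists l, is_sumZ f l.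
Proof.
  intros H (m1 & m2 & H3 & H4 & ->).
  destruct (series_dominated (fun n => f (Z.of_nat n)) _ M _ (fun n => H _) H3) as [a Ha].
  destruct (series_dominated (fun n => f (- Z.of_nat n - 1)%Z) _ M _ (fun n => H _) H4) as [b Hb].
  exists (a + b), a, b; auto.
Qed.

Lemma is_series_single (c : R) (j : nat) :
  is_series (fun n => if Nat.eq_dec n j then c else 0) c.
Proof.
  apply is_series_lim.
  apply is_lim_seq_ext_loc with (fun _ => c); [|apply is_lim_seq_const].
  exists j. intros n Hn.
  assert (forall n, sum_f_R0 (fun n => if Nat.eq_dec n j then c else 0) n =
    if le_dec j n then c else 0) as ->.
  { clear; induction n as [|n IH]; cbn [sum_f_R0].
    - destruct (Nat.eq_dec 0 j), (le_dec j 0); try lra; lia.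
    - rewrite IH. destruct (le_dec j n), (le_dec j (S n)), (Nat.eq_dec (S n) j); try lra; lia. }
  destruct (le_dec j n); [auto|lia].
Qed.

Lemma is_series_zero (f : nat -> R) : (forall n, f n = 0) -> is_series f 0.
Proof.
  intros H. apply is_series_lim. apply is_lim_seq_ext with (fun _ => 0); [|apply is_lim_seq_const].
  intros n; induction n as [|n IH]; simpl; rewrite ?H; auto. rewrite <- IH; ring.
Qed.

Lemma is_sumZ_single (f : Z -> R) (x : Z) :
  is_sumZ (fun y => (if Z.eq_dec x y then 1 else 0) * f y) (f x).
Proof.
  destruct (Z_le_gt_dec 0 x) as [Hx|Hx].
  - exists (f x), 0; repeat split; [| |ring].
    + eapply is_series_ext; [|apply (is_series_single (f x) (Z.to_nat x))].
      intros n; simpl. destruct (Nat.eq_dec n (Z.to_nat x)), (Z.eq_dec x (Z.of_nat n));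
        try lia; subst; rewrite ?Z2Nat.id; auto; ring.
    + apply is_series_zero. intros n. destruct (Z.eq_dec x (- Z.of_nat n - 1)); [lia|ring].
  - exists 0, (f x); repeat split; [| |ring].
    + apply is_series_zero. intros n. destruct (Z.eq_dec x (Z.of_nat n)); [lia|ring].
    + eapply is_series_ext; [|apply (is_series_single (f x) (Z.to_nat (- x - 1)))].
      intros n; simpl. destruct (Nat.eq_dec n (Z.to_nat (- x - 1))), (Z.eq_dec x (- Z.of_nat n - 1));
        try lia; try ring. rewrite <- e0; ring.
Qed.

Lemma tonelli_Z (A : nat -> Z -> R) (r : nat -> R) (S : R) :
  (forall n y, 0 <= A n y) -> (forall n, is_sumZ (A n) (r n)) -> is_series r S ->
  is_sumZ (fun y => Series (fun n => A n y)) S.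
Proof.
  intros HA Hr HS.
  set (r1 := fun n => Series (fun k => A n (Z.of_nat k))).
  set (r2 := fun n => Series (fun k => A n (- Z.of_nat k - 1)%Z)).
  assert (Hr12 : forall n, is_series (fun k => A n (Z.of_nat k)) (r1 n) /\
    is_series (fun k => A n (- Z.of_nat k - 1)%Z) (r2 n) /\ r n = r1 n + r2 n).
  { intros n. destruct (Hr n) as (l1 & l2 & H1 & H2 & E). unfold r1, r2.
    now rewrite (is_series_unique _ _ H1), (is_series_unique _ _ H2). }
  assert (H1p : forall n, 0 <= r1 n).
  { intros n. eapply is_series_nonneg; [|exact (proj1 (Hr12 n))]. intros; apply HA. }
  assert (H2p : forall n, 0 <= r2 n).
  { intros n. eapply is_series_nonneg; [|exact (proj1 (proj2 (Hr12 n)))]. intros; apply HA. }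
  destruct (series_dominated r1 r 1 S) as [S1 HS1]; auto.
  { intros n. destruct (Hr12 n) as (_ & _ & ->). specialize (H1p n); specialize (H2p n); lra. }
  destruct (series_dominated r2 r 1 S) as [S2 HS2]; auto.
  { intros n. destruct (Hr12 n) as (_ & _ & ->). specialize (H1p n); specialize (H2p n); lra. }
  destruct (tonelli (fun n k => A n (Z.of_nat k)) r1 S1) as (c1 & Hc1 & Hs1); auto.
  { intros n; exact (proj1 (Hr12 n)). }
  destruct (tonelli (fun n k => A n (- Z.of_nat k - 1)%Z) r2 S2) as (c2 & Hc2 & Hs2); auto.
  { intros n; exact (proj1 (proj2 (Hr12 n))). }
  exists S1, S2; repeat split.
  - apply is_series_ext with c1; auto. intros k. symmetry. apply is_series_unique, Hc1.
  - apply is_series_ext with c2; auto. intros k. symmetry. apply is_series_unique, Hc2.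
  - apply (is_series_eq r); auto. apply is_series_ext with (fun n => r1 n + r2 n).
    + intros n. symmetry; exact (proj2 (proj2 (Hr12 n))).
    + now apply (is_series_add r1 r2).
Qed.

(** Both halves are truncated at [N]; first [n] tends to infinity inside the finite sums, then
    [N]. *)
Lemma fatou_Z (f : nat -> Z -> R) (F : Z -> R) (l : nat -> R) (L T : R) :
  (forall n y, 0 <= f n y) -> (forall n, is_sumZ (f n) (l n)) -> (forall n, l n <= L) ->
  (forall y, is_lim_seq (fun n => f n y) (F y)) -> is_sumZ F T -> T <= L.
Proof.
  intros Hf Hl HL HF (T1 & T2 & H1 & H2 & ->).
  apply is_series_lim in H1, H2.
  refine (is_lim_seq_le _ (fun _ => L) (Finite (T1 + T2)) L _ _ (is_lim_seq_const L)).
  2: now apply is_lim_seq_plus'; [exact H1|exact H2].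
  intros N; simpl.
  assert (Hlim : forall (i : nat -> Z), is_lim_seq (fun n => sum_f_R0 (fun k => f n (i k)) N)
     (sum_f_R0 (fun k => F (i k)) N)).
  { intros i. induction N as [|N IH]; simpl; [apply HF|]. now apply is_lim_seq_plus'; [|apply HF]. }
  refine (is_lim_seq_le _ (fun _ => L) (Finite _) L _ 
    (is_lim_seq_plus' _ _ _ _ (Hlim Z.of_nat) (Hlim (fun k => (- Z.of_nat k - 1)%Z)))
    (is_lim_seq_const L)).
  intros n; simpl. eapply Rle_trans; [|apply (HL n)].
  destruct (Hl n) as (m1 & m2 & Hm1 & Hm2 & ->).
  apply Rplus_le_compat.
  - now apply (sum_le_series (fun k => f n (Z.of_nat k))).
  - now apply (sum_le_series (fun k => f n (- Z.of_nat k - 1)%Z)).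
Qed.

(** * Divergence of the harmonic series *)

Definition harmonic (N : nat) : R := sum_f_R0 (fun n => / INR (S n)) N.

Lemma harmonic_unbounded (C : R) : exists N, C < harmonic N.
Proof.
  assert (H : forall N, ln (INR (S (S N))) <= harmonic N).
  { assert (Hs : forall n, ln (INR (S (S n))) <= ln (INR (S n)) + / INR (S n)).
    { intros n. assert (0 < INR (S n)) by (apply lt_0_INR; lia).
      assert (0 < / INR (S n)) by now apply Rinv_0_lt_compat.
      rewrite <- (ln_exp (/ INR (S n))), <- ln_mult; auto using exp_pos.
      apply ln_le; [apply lt_0_INR; lia|].
      pose proof (exp_ineq1 (/ INR (S n))).
      replace (INR (S (S n))) with (INR (S n) * (1 + / INR (S n))).
      - apply Rmult_le_compat_l; lra.
      - rewrite (S_INR (S n)). field. lra. }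
    intros N; induction N as [|N IH]; unfold harmonic in *.
    - pose proof (Hs 0%nat). cbn [sum_f_R0]. change (INR 1) with 1 in *. rewrite ln_1 in H. lra.
    - cbn [sum_f_R0]. pose proof (Hs (S N)). lra. }
  destruct (INR_unbounded (exp C)) as [n Hn].
  exists n. eapply Rlt_le_trans; [|apply H].
  rewrite <- (ln_exp C). apply ln_increasing; [apply exp_pos|].
  rewrite !S_INR. lra.
Qed.

(** * The simple random walk and its Green function *)

Lemma Pk_succ (k : nat) (x y : Z) :
  Pk (S k) x y = / 2 * Pk k (x - 1)%Z y + / 2 * Pk k (x + 1)%Z y.
Proof. reflexivity. Qed.

Lemma Pk_nonneg (k : nat) (x y : Z) : 0 <= Pk k x y.
Proof.
  revert x; induction k as [|k IH]; intros x; simpl.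
  - destruct (Z.eq_dec x y); lra.
  - pose proof (IH (x - 1)%Z); pose proof (IH (x + 1)%Z); lra.
Qed.

Lemma Pk_le_1 (k : nat) (x y : Z) : Pk k x y <= 1.
Proof.
  revert x; induction k as [|k IH]; intros x; simpl.
  - destruct (Z.eq_dec x y); lra.
  - pose proof (IH (x - 1)%Z); pose proof (IH (x + 1)%Z); lra.
Qed.

Lemma Pk_shift (k : nat) (x y : Z) : Pk k x y = Pk k (x - y)%Z 0%Z.
Proof.
  revert x; induction k as [|k IH]; intros x; simpl.
  - destruct (Z.eq_dec x y), (Z.eq_dec (x - y) 0); auto; lia.
  - rewrite (IH (x - 1)%Z), (IH (x + 1)%Z).
    replace (x - 1 - y)%Z with (x - y - 1)%Z by lia.
    now replace (x + 1 - y)%Z with (x - y + 1)%Z by lia.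
Qed.

Lemma Pk_opp (k : nat) (d : Z) : Pk k (- d)%Z 0%Z = Pk k d 0%Z.
Proof.
  revert d; induction k as [|k IH]; intros d; simpl.
  - destruct (Z.eq_dec (- d) 0), (Z.eq_dec d 0); auto; lia.
  - rewrite <- (IH (d - 1)%Z), <- (IH (d + 1)%Z), Rplus_comm.
    replace (- (d - 1))%Z with (- d + 1)%Z by lia.
    now replace (- (d + 1))%Z with (- d - 1)%Z by lia.
Qed.

Lemma Pk_pos (k : nat) : 0 < Pk k (Z.of_nat k) 0%Z.
Proof.
  induction k as [|k IH].
  - simpl. lra.
  - rewrite Pk_succ. replace (Z.of_nat (S k) - 1)%Z with (Z.of_nat k) by lia.
    pose proof (Pk_nonneg k (Z.of_nat (S k) + 1) 0). lra.
Qed.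

(* The absorption identities of the binomial coefficients, with no parity
   condition on [k + d]. *)
Lemma Pk_absorption (k : nat) (d : Z) :
  (INR k + 1 + IZR d) * Pk (S k) d 0%Z = (INR k + 1) * Pk k (d - 1)%Z 0%Z /\
  (INR k + 1 - IZR d) * Pk (S k) d 0%Z = (INR k + 1) * Pk k (d + 1)%Z 0%Z.
Proof.
  revert d; induction k as [|k IH]; intros d.
  - simpl. destruct (Z.eq_dec (d - 1) 0) as [E|E], (Z.eq_dec (d + 1) 0) as [E'|E'].
    + lia.
    + replace d with 1%Z by lia. lra.
    + replace d with (-1)%Z by lia. lra.
    + lra.
  - pose proof (IH (d - 1)%Z) as [H1 H2]. pose proof (IH (d + 1)%Z) as [H3 H4].
    rewrite minus_IZR in H1, H2. rewrite plus_IZR in H3, H4.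
    replace (d - 1 + 1)%Z with d in H2 by lia. replace (d + 1 - 1)%Z with d in H3 by lia.
    rewrite !(Pk_succ (S k)), S_INR.
    split; nra.
Qed.

(** By absorption both sides are multiples of [Pk (S k) d 0], with factors proportional to
    [k + 1 - d] and [k + 1 + d]. The step is two because [Pk k d 0] vanishes when [k + d] is odd. *)
Lemma Pk_le_two_steps (k : nat) (d : Z) : (0 <= d)%Z -> Pk k (d + 1)%Z 0%Z <= Pk k (d - 1)%Z 0%Z.
Proof.
  intros Hd. destruct (Pk_absorption k d) as [H1 H2].
  apply IZR_le in Hd. pose proof (pos_INR k).
  pose proof (Pk_nonneg (S k) d 0).
  apply (Rmult_le_reg_l (INR k + 1)); [lra|]. rewrite <- H1, <- H2.
  apply Rmult_le_compat_r; lra.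
Qed.

(** By parity exactly one of the two terms is nonzero, and it is the maximum of [Pk k] over the
    starting points; the sum avoids a case distinction on the parity of [k]. *)
Definition center (k : nat) : R := Pk k 0%Z 0%Z + Pk k 1%Z 0%Z.

Lemma Pk_le_center (k : nat) (d : Z) : Pk k d 0%Z <= center k.
Proof.
  assert (H : forall n, Pk k (Z.of_nat n) 0%Z <= center k /\ Pk k (Z.of_nat (S n)) 0%Z <= center k).
  { unfold center. pose proof (Pk_nonneg k 0 0); pose proof (Pk_nonneg k 1 0).
    induction n as [|n IH]; [simpl; lra|].
    split; [apply IH|].
    eapply Rle_trans; [|apply (proj1 IH)].
    replace (Z.of_nat (S (S n))) with (Z.of_nat (S n) + 1)%Z by lia.
    eapply Rle_trans; [apply Pk_le_two_steps; lia|].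
    right. f_equal. lia. }
  destruct (Z_le_gt_dec 0 d).
  - rewrite <- (Z2Nat.id d); auto. apply H.
  - rewrite <- Pk_opp, <- (Z2Nat.id (- d)) by lia. apply H.
Qed.

Lemma center_nonneg (k : nat) : 0 <= center k.
Proof. eapply Rle_trans; [apply (Pk_nonneg k 0 0)|apply Pk_le_center]. Qed.

Lemma center_succ (k : nat) :
  center (S k) = Pk k 1%Z 0%Z + (INR k + 1) / (INR k + 2) * Pk k 0%Z 0%Z.
Proof.
  unfold center. pose proof (pos_INR k).
  destruct (Pk_absorption k 1) as [H1 _].
  replace (Pk (S k) 1 0) with ((INR k + 1) / (INR k + 2) * Pk k 0 0)%R.
  - rewrite Pk_succ. change (0 - 1)%Z with (- (1))%Z. rewrite Pk_opp. simpl. lra.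
  - simpl Z.sub in H1. apply (Rmult_eq_reg_l (INR k + 2)); [|lra].
    transitivity ((INR k + 1) * Pk k 0 0); [field; lra|]. rewrite <- H1. ring.
Qed.

(** The exact ratio is [(k+1)/(k+2)] for even [k] and [(k+2)/(k+3)] for odd [k]; the larger one
    serves for both parities. *)
Lemma center_two_steps (k : nat) :
  center (S (S k)) <= (INR k + 2) / (INR k + 3) * center k.
Proof.
  rewrite center_succ.
  destruct (Pk_absorption k 1) as [H1 _]. simpl Z.sub in H1.
  assert (H2 : Pk (S k) 0 0 = Pk k 1 0).
  { rewrite Pk_succ. change (0 - 1)%Z with (- (1))%Z. rewrite Pk_opp. simpl. lra. }
  rewrite H2, S_INR. unfold center. pose proof (pos_INR k).
  assert (H3 : Pk (S k) 1 0 = (INR k + 1) / (INR k + 2) * Pk k 0 0).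
  { apply (Rmult_eq_reg_l (INR k + 2)); [|lra].
    transitivity ((INR k + 1) * Pk k 0 0); [rewrite <- H1; ring|field; lra]. }
  rewrite H3. replace (INR k + 1 + 1) with (INR k + 2) by ring.
  replace (INR k + 1 + 2) with (INR k + 3) by ring.
  pose proof (Pk_nonneg k 0 0).
  assert ((INR k + 1) / (INR k + 2) <= (INR k + 2) / (INR k + 3)).
  { apply Rle_div_l; [lra|]. replace ((INR k + 2) / (INR k + 3) * (INR k + 2)) with
      ((INR k + 1) + / (INR k + 3)) by (field; lra).
    assert (0 < / (INR k + 3)) by (apply Rinv_0_lt_compat; lra). lra. }
  nra.
Qed.

(** * The coefficients of (1 - t)^(-s) and the Green function *)

Fixpoint green_coef (s : R) (k : nat) : R :=
  match k with
  | O => 1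
  | S k' => green_coef s k' * (s + INR k') / INR (S k')
  end.

Lemma green_coef_succ (s : R) (k : nat) :
  (INR k + 1) * green_coef s (S k) = (s + INR k) * green_coef s k.
Proof.
  cbn [green_coef]. rewrite S_INR. pose proof (pos_INR k). field. lra.
Qed.

Lemma green_coef_nonneg (s : R) (k : nat) : 0 <= s -> 0 <= green_coef s k.
Proof.
  intros Hs. induction k as [|k IH]; cbn [green_coef]; [lra|].
  pose proof (pos_INR k). rewrite S_INR.
  apply Rdiv_le_0_compat; [apply Rmult_le_pos|]; lra.
Qed.

Section Coefficients.

Variable s : R.
Hypothesis Hs : 0 < s < / 2.

Notation a := (green_coef s).

(** A majorant of [a k * Pk k x y], uniform in [x] and [y]. It has order [k^(s - 3/2)], hence is
    summable for [s < 1/2]; the telescoping inequality below replaces these asymptotics. *)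
Let B (k : nat) : R := a k * center k.

Lemma green_major_nonneg (k : nat) : 0 <= B k.
Proof. apply Rmult_le_pos; [apply green_coef_nonneg; lra|apply center_nonneg]. Qed.

Lemma green_major_telescope (k : nat) :
  (1 - 2 * s) * B k <= (INR k + 1) * B k - (INR k + 3) * B (S (S k)).
Proof.
  pose proof (pos_INR k) as Hk. pose proof (green_major_nonneg k) as HB.
  pose proof (green_coef_nonneg s k ltac:(lra)) as Ha. pose proof (center_two_steps k) as Hc.
  assert (Ha2 : a (S (S k)) = (s + INR k) * (s + INR k + 1) / ((INR k + 1) * (INR k + 2)) * a k).
  { cbn [green_coef]. rewrite !S_INR. field. lra. }
  assert (Ha3 : 0 <= a (S (S k))) by (apply green_coef_nonneg; lra).
  assert (H : (INR k + 3) * B (S (S k)) <= (s + INR k) * (s + INR k + 1) / (INR k + 1) * B k).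
  { unfold B. transitivity ((INR k + 3) * (a (S (S k)) * ((INR k + 2) / (INR k + 3) * center k))).
    - apply Rmult_le_compat_l; [lra|]. now apply Rmult_le_compat_l.
    - right. rewrite Ha2. field. lra. }
  assert ((s + INR k) * (s + INR k + 1) / (INR k + 1) <= INR k + 2 * s).
  { apply Rle_div_l; [lra|]. nra. }
  nra.
Qed.

Lemma green_major_summable : exists l, is_series B l.
Proof.
  destruct (series_bounded B ((B 0%nat + 2 * B 1%nat) / (1 - 2 * s))) as [l [Hl _]];
    [apply green_major_nonneg| |now exists l].
  intros N. apply Rle_div_r; [lra|].
  (* With [u k = (k+1) B k], the right-hand side is [u 0 + u 1 - u (N+1) - u (N+2)], which is what
     telescoping with step two leaves. *)
  assert (H : sum_f_R0 B N * (1 - 2 * s) <=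
    B 0%nat + 2 * B 1%nat - (INR N + 2) * B (S N) - (INR N + 3) * B (S (S N))).
  { induction N as [|N IH]; cbn [sum_f_R0].
    - pose proof (green_major_telescope 0). simpl INR in *. lra.
    - pose proof (green_major_telescope (S N)). rewrite S_INR in *. lra. }
  pose proof (pos_INR N). pose proof (green_major_nonneg (S N)).
  pose proof (green_major_nonneg (S (S N))). nra.
Qed.

(* [(k+1) B k + (k+2) B (k+1)] is nonincreasing; a positive limit would make
   [B] dominate a harmonic series. *)
Lemma green_major_small : is_lim_seq (fun k => (INR k + 1) * B k) 0.
Proof.
  set (W := fun k => (INR k + 1) * B k + (INR k + 2) * B (S k)).
  assert (HB := green_major_nonneg).
  assert (HW0 : forall k, 0 <= W k).
  { intros k. unfold W. pose proof (pos_INR k). pose proof (HB k). pose proof (HB (S k)). nra. }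
  assert (HWd : forall k, W (S k) <= W k).
  { intros k. unfold W. pose proof (green_major_telescope k). pose proof (HB k). rewrite S_INR. nra. }
  destruct (ex_finite_lim_seq_decr W 0 HWd HW0) as [L HL].
  assert (HL0 : forall k, L <= W k).
  { intros k. apply (is_lim_seq_decr_compare W L HL HWd). }
  assert (L <= 0).
  { destruct (Rle_lt_dec L 0) as [|HLp]; auto. exfalso.
    destruct green_major_summable as [l Hl].
    destruct (harmonic_unbounded (2 * (2 * l) / L)) as [N HN].
    (* This comes from [L <= W k <= 2 (k+1) (B k + B (k+1))]. The right-hand side is at most [2 l],
       against the choice of [N]. *)
    assert (Hsum : L / 2 * harmonic N <= sum_f_R0 (fun k => B k + B (S k)) N).
    { unfold harmonic. rewrite scal_sum. apply sum_Rle. intros k _.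
      pose proof (pos_INR k). rewrite S_INR. 
      rewrite Rmult_comm. apply Rle_div_l; [lra|].
      pose proof (HL0 k). unfold W in *. pose proof (HB k). pose proof (HB (S k)). nra. }
    rewrite sum_plus in Hsum.
    assert (sum_f_R0 B N <= l) by (apply sum_le_series; auto).
    assert (sum_f_R0 (fun k => B (S k)) N <= l).
    { pose proof (sum_le_series B l (S N) HB Hl) as H'. rewrite decomp_sum in H' by lia.
      simpl pred in H'. pose proof (HB 0%nat). lra. }
    apply Rlt_div_l in HN; [|lra]. lra. }
  assert (L = 0) as ->.
  { apply Rle_antisym; auto.
    apply (is_lim_seq_le (fun _ => 0) W 0 L); auto. apply is_lim_seq_const. }
  apply (is_lim_seq_le_le (fun _ => 0) _ W); auto using is_lim_seq_const.
  intros k. unfold W. pose proof (pos_INR k). pose proof (HB k). pose proof (HB (S k)). split; nra.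
Qed.

Lemma green_series (x b : Z) : exists l, is_series (fun k => a k * Pk k x b) l.
Proof.
  destruct green_major_summable as [l Hl].
  apply (series_dominated _ B 1 l); auto.
  intros k. rewrite Rmult_1_l, Pk_shift. pose proof (green_coef_nonneg s k ltac:(lra)). split.
  - apply Rmult_le_pos; auto using Pk_nonneg.
  - apply Rmult_le_compat_l; auto using Pk_le_center.
Qed.

Definition green (d : Z) : R := Series (fun k => a k * Pk k d 0%Z).

Lemma green_is_series (x b : Z) : is_series (fun k => a k * Pk k x b) (green (x - b)).
Proof.
  destruct (green_series x b) as [l Hl].
  unfold green. apply (is_series_ext _ (fun k => a k * Pk k (x - b)%Z 0%Z)) in Hl.
  - rewrite (is_series_unique _ _ Hl). eapply is_series_ext; [|apply Hl].
    intros k; simpl. now rewrite <- Pk_shift.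
  - intros k. now rewrite <- Pk_shift.
Qed.

Lemma green_opp (d : Z) : green (- d) = green d.
Proof. apply Series_ext. intros k. now rewrite Pk_opp. Qed.

(* The right-hand side is [V k - V (k+2)] with the Zeilberger certificate
   [V k = (k - d) a_k P^k(d, 0)]; summing over [k] gives [green_rec_nonneg]. *)
Lemma green_telescope (k : nat) (d : Z) :
  (IZR d + 1 - s) * (a (S k) * Pk (S k) (d + 1)%Z 0%Z) - (IZR d + s) * (a k * Pk k d 0%Z) =
  (INR k - IZR d) * (a k * Pk k d 0%Z)
  - (INR (S (S k)) - IZR d) * (a (S (S k)) * Pk (S (S k)) d 0%Z).
Proof.
  pose proof (pos_INR k).
  destruct (Pk_absorption (S k) d) as [_ H1].
  destruct (Pk_absorption k (d + 1)) as [H2 _].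
  replace (d + 1 - 1)%Z with d in H2 by lia. rewrite plus_IZR in H2.
  pose proof (green_coef_succ s k) as H3. pose proof (green_coef_succ s (S k)) as H4.
  rewrite !S_INR in *.
  set (p := Pk (S k) (d + 1) 0) in *. set (q := Pk (S (S k)) d 0) in *. set (r := Pk k d 0) in *.
  apply (Rmult_eq_reg_l (INR k + 1 + 1)); [|lra].
  assert (E : (INR k + 1 + 1) * ((INR k + 1 + 1 - IZR d) * (a (S (S k)) * q)) =
    (s + (INR k + 1)) * a (S k) * ((INR k + 1 + 1) * p)).
  { rewrite <- H1, <- H4. ring. }
  assert (E' : (INR k + IZR d + 2) * a (S k) * p = (s + INR k) * a k * r).
  { apply (Rmult_eq_reg_l (INR k + 1)); [|lra].
    transitivity (a (S k) * (INR k + 1) * ((INR k + 1 + (IZR d + 1)) * p)); [ring|].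
    rewrite H2. transitivity ((INR k + 1) * a (S k) * (INR k + 1) * r); [ring|]. rewrite H3. ring. }
  rewrite Rmult_minus_distr_l with (r2 := (INR k - IZR d) * (a k * r)). rewrite E.
  apply (f_equal (fun t => (INR k + 1 + 1) * t)) in E'. lra.
Qed.

Lemma green_rec_nonneg (d : Z) :
  (0 <= d)%Z -> (IZR d + 1 - s) * green (d + 1) = (IZR d + s) * green d.
Proof.
  intros Hd.
  set (V := fun k => (INR k - IZR d) * (a k * Pk k d 0%Z)).
  (* The boundary terms at infinity vanish because [|V k| <= (d+1) (k+1) B k]. *)
  assert (HV : is_lim_seq V 0).
  { assert (Hd' := IZR_le _ _ Hd).
    apply (is_lim_seq_le_le (fun k => - (IZR d + 1) * ((INR k + 1) * B k)) _
                             (fun k => (IZR d + 1) * ((INR k + 1) * B k))).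
    - intros k. unfold V, B.
      pose proof (Pk_le_center k d). pose proof (Pk_nonneg k d 0).
      pose proof (green_coef_nonneg s k ltac:(lra)). pose proof (pos_INR k).
      set (t := a k * Pk k d 0). assert (0 <= t <= a k * center k) by (unfold t; nra).
      assert (0 <= INR k * IZR d) by nra.
      split; nra.
    - replace (Finite 0) with (Rbar_mult (- (IZR d + 1)) 0) by (simpl; f_equal; ring).
      apply is_lim_seq_scal_l, green_major_small.
    - replace (Finite 0) with (Rbar_mult (IZR d + 1) 0) by (simpl; f_equal; ring).
      apply is_lim_seq_scal_l, green_major_small. }
  assert (H0 := green_is_series d 0). assert (H1 := green_is_series (d + 1) 0).
  rewrite Z.sub_0_r in H0, H1.
  (* The index can be shifted since the term [k = 0] of [g (d+1)] is zero: [d >= 0] excludes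
     [d + 1 = 0]. *)
  assert (H1' : is_series (fun k => a (S k) * Pk (S k) (d + 1)%Z 0%Z) (green (d + 1))).
  { apply (is_series_incr_1 (fun k => a k * Pk k (d + 1)%Z 0%Z)). simpl.
    destruct (Z.eq_dec (d + 1) 0); [lia|].
    rewrite Rmult_0_r. unfold plus; simpl. now rewrite Rplus_0_r. }
  apply (is_series_cmult (IZR d + s)) in H0.
  apply (is_series_cmult (IZR d + 1 - s)) in H1'.
  assert (H := is_series_sub _ _ _ _ H1' H0).
  apply (is_series_ext _ (fun k => V k - V (S (S k)))) in H;
    [|intros k; apply green_telescope].
  apply is_series_lim in H.
  assert (H' : is_lim_seq (fun N => - (V (S N) + V (S (S N)))) 0).
  { replace (Finite 0) with (Rbar_opp (0 + 0)) by (simpl; f_equal; ring).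
    apply is_lim_seq_opp with (l := Finite (0 + 0)), is_lim_seq_plus'.
    - now apply (is_lim_seq_incr_1 V).
    - now apply (is_lim_seq_incr_1 (fun n => V (S n))), (is_lim_seq_incr_1 V). }
  apply (is_lim_seq_ext _ (fun N => - (V (S N) + V (S (S N))))) in H.
  - apply is_lim_seq_unique in H, H'. rewrite H in H'. injection H'.
    lra.
  (* [V 0] could be nonzero only at [d = 0] and [V 1] only at [|d| = 1]; the factors [0 - d] and
     [1 - d] cancel these for [d >= 0]. *)
  - assert (V 0%nat + V 1%nat = 0).
    { unfold V. simpl. destruct (Z.eq_dec d 0); [subst; simpl; lra|].
      destruct (Z.eq_dec (d + 1) 0); [lia|]. destruct (Z.eq_dec (d - 1) 0); [|lra].
      replace d with 1%Z by lia. lra. }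
    intros N. induction N as [|N IH]; cbn [sum_f_R0]; [lra|].
    rewrite IH. lra.
Qed.

(** Since [g] is even, the reflection [d -> -d - 1] exchanges the two sides of the recurrence up to
    sign, which reduces negative [d] to [green_rec_nonneg]. *)
Lemma green_rec (d : Z) : (IZR d + 1 - s) * green (d + 1) = (IZR d + s) * green d.
Proof.
  destruct (Z_le_gt_dec 0 d) as [|Hd]; [now apply green_rec_nonneg|].
  pose proof (green_rec_nonneg (- d - 1) ltac:(lia)) as H.
  rewrite <- (green_opp (d + 1)), <- (green_opp d).
  replace (- d - 1 + 1)%Z with (- d)%Z in H by lia.
  replace (- (d + 1))%Z with (- d - 1)%Z by lia.
  rewrite minus_IZR, opp_IZR in H. lra.
Qed.

End Coefficients.

(** * The stable kernel *)

Lemma is_series_finite (f : nat -> R) (N : nat) :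
  (forall n, (N < n)%nat -> f n = 0) -> is_series f (sum_f_R0 f N).
Proof.
  intros H. apply is_series_lim.
  apply is_lim_seq_ext_loc with (fun _ => sum_f_R0 f N); [|apply is_lim_seq_const].
  exists N. intros n Hn. induction Hn as [|n Hn IH]; auto.
  cbn [sum_f_R0]. rewrite <- IH, H; [ring|lia].
Qed.

Lemma is_series_drop (f : nat -> R) (N : nat) (l : R) :
  (forall n, (n < N)%nat -> f n = 0) -> is_series f l -> is_series (fun k => f (N + k)%nat) l.
Proof.
  revert f; induction N as [|N IH]; intros f H Hf; [exact Hf|].
  apply (IH (fun k => f (S k))).
  - intros n Hn. apply H. lia.
  - apply is_series_incr_1. rewrite H by lia. unfold plus; simpl. now rewrite Rplus_0_r.
Qed.

Fixpoint Pn (n : nat) (f : Z -> R) (x : Z) : R :=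
  match n with
  | O => f x
  | S n' => / 2 * Pn n' f (x - 1)%Z + / 2 * Pn n' f (x + 1)%Z
  end.

Lemma Pn_sumZ (n : nat) (f : Z -> R) (x : Z) : is_sumZ (fun y => Pk n x y * f y) (Pn n f x).
Proof.
  revert x; induction n as [|n IH]; intros x; simpl.
  - apply is_sumZ_single.
  - eapply is_sumZ_ext; [|apply is_sumZ_plus; apply is_sumZ_scal; apply IH].
    intros y; simpl; ring.
Qed.

Section StableKernel.

Variable alpha : R.
Hypothesis Halpha : 0 < alpha < 1.

Let s : R := alpha / 2.

Lemma half_alpha_bounds : 0 < s < / 2.
Proof. unfold s. lra. Qed.

Notation a := (green_coef s).
Notation c := (ck alpha).
Notation g := (green s).

(** With the index [0] included, [ck alpha] is the coefficient sequence of [-(1 - t)^s], although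
    [P_alpha] starts at index [1]. *)
Lemma ck_0 : c 0%nat = -1.
Proof. unfold ck; simpl. ring. Qed.

Lemma ck_succ (k : nat) : (INR k + 1) * c (S k) = (INR k - s) * c k.
Proof.
  unfold ck. cbn [gbinom]. rewrite <- !tech_pow_Rmult, S_INR. fold s.
  pose proof (pos_INR k). field. lra.
Qed.

Lemma ck_pos (k : nat) : 0 < c (S k).
Proof.
  pose proof half_alpha_bounds.
  induction k as [|k IH].
  - pose proof (ck_succ 0) as E. rewrite ck_0 in E. simpl INR in E. lra.
  - pose proof (ck_succ (S k)) as E. rewrite S_INR in E. pose proof (pos_INR k).
    apply (Rmult_lt_reg_l (INR k + 1 + 1)); [lra|]. rewrite E, Rmult_0_r.
    apply Rmult_lt_0_compat; lra.
Qed.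

(* Gosper's closed form of the partial sums of the convolution identity
   [(1 - t)^s (1 - t)^(-s) = 1]; it vanishes at [J = S m]. *)
Lemma convolution_partial (m J : nat) :
  (J <= S m)%nat ->
  s * INR (S m) * sum_f_R0 (fun j => c j * a (S m - j)%nat) J =
  (s - INR J) * INR (S m - J) * (c J * a (S m - J)%nat).
Proof.
  induction J as [|J IH]; intros HJ; cbn [sum_f_R0].
  - rewrite Nat.sub_0_r. simpl (INR 0). ring.
  - rewrite Rmult_plus_distr_l, IH by lia.
    replace (S m - J)%nat with (S (m - J)) by lia.
    replace (S m - S J)%nat with (m - J)%nat by lia.
    pose proof (ck_succ J) as Hc. pose proof (green_coef_succ s (m - J)) as Ha.
    replace (INR (S m)) with (INR (m - J) + INR J + 1)
      by (rewrite <- plus_INR, <- S_INR; f_equal; lia).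
    rewrite !S_INR.
    transitivity (- ((INR J - s) * c J) * ((INR (m - J) + 1) * a (S (m - J)))
      + s * (INR (m - J) + INR J + 1) * (c (S J) * a (m - J)%nat)); [ring|].
    rewrite <- Hc, Ha. ring.
Qed.

(** The coefficient of [t^(m+1)] in [(1 - t)^s (1 - t)^(-s) = 1], with the term of [c 0 = -1] moved
    to the right. It is the coefficient form of [P_alpha g = g - delta]. *)
Lemma convolution (m : nat) :
  sum_f_R0 (fun j => c (S j) * a (m - j)%nat) m = a (S m).
Proof.
  pose proof (convolution_partial m (S m) (le_n _)) as H.
  rewrite Nat.sub_diag in H. simpl (INR 0) in H.
  pose proof half_alpha_bounds. assert (0 < INR (S m)) by (apply lt_0_INR; lia).
  assert (H' : sum_f_R0 (fun j => c j * a (S m - j)%nat) (S m) = 0).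
  { apply (Rmult_eq_reg_l (s * INR (S m))).
    - rewrite H. ring.
    - apply Rgt_not_eq, Rmult_lt_0_compat; lra. }
  rewrite decomp_sum in H' by lia. simpl pred in H'. rewrite Nat.sub_0_r, ck_0 in H'.
  simpl (S m - S _)%nat in H'. lra.
Qed.

(** Dividing [(1 - t)^s] by [1 - t] sums its coefficients, and [s (1 - t)^(s-1)] is the derivative
    of [-(1 - t)^s], whose coefficients are [(k+1) c (k+1)]. *)
Lemma ck_tail (N : nat) :
  s * (1 - sum_f_R0 (fun n => c (S n)) N) = (INR N + 2) * c (S (S N)).
Proof.
  induction N as [|N IH]; cbn [sum_f_R0].
  - pose proof (ck_succ 1) as H1. pose proof (ck_succ 0) as H0. rewrite ck_0 in H0.
    simpl INR in *. lra.
  - pose proof (ck_succ (S (S N))) as H. rewrite !S_INR in *.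
    rewrite Rminus_plus_distr, Rmult_minus_distr_l, IH. lra.
Qed.

Lemma is_series_ck : is_series (fun n => c (S n)) 1.
Proof.
  pose proof half_alpha_bounds as Hs.
  set (t := fun N => 1 - sum_f_R0 (fun n => c (S n)) N).
  assert (Ht0 : forall N, 0 <= t N).
  { intros N. pose proof (ck_tail N) as H. fold (t N) in H.
    pose proof (ck_pos (S N)). pose proof (pos_INR N).
    apply (Rmult_le_reg_l s); [lra|]. rewrite H, Rmult_0_r. apply Rmult_le_pos; lra. }
  assert (Hts : forall N, t (S N) = t N * (1 - s * / INR (S (S N)))).
  { intros N. pose proof (ck_tail N) as H. fold (t N) in H.
    assert (E : t (S N) = t N - c (S (S N))) by (unfold t; cbn [sum_f_R0]; ring).
    rewrite E. rewrite !S_INR. pose proof (pos_INR N).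
    replace (c (S (S N))) with (s * t N / (INR N + 1 + 1)); [field; lra|].
    rewrite H. field. lra. }
  (* The factors [1 - s/(N+2)] of the remainder force decay at the rate of [1 / (s * harmonic N)],
     because [(1 - s i) (1 + s h + s i) <= 1 + s h]. *)
  assert (Hth : forall N, t N * (1 + s * harmonic N) <= 1).
  { assert (Hh : forall N, 0 <= harmonic N).
    { intros N. apply cond_pos_sum. intros n. left. apply Rinv_0_lt_compat, lt_0_INR. lia. }
    induction N as [|N IH].
    - unfold t, harmonic. cbn [sum_f_R0]. pose proof (ck_succ 0) as H0. rewrite ck_0 in H0.
      simpl INR in *. rewrite Rinv_1. nra.
    - rewrite Hts. change (harmonic (S N)) with (harmonic N + / INR (S (S N))).
      set (i := / INR (S (S N))).
      assert (0 < i) by (apply Rinv_0_lt_compat, lt_0_INR; lia).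
      eapply Rle_trans; [|apply IH]. rewrite Rmult_assoc.
      apply Rmult_le_compat_l; auto.
      pose proof (Hh N). assert (0 <= s * i) by nra. assert (0 <= s * harmonic N) by nra. nra. }
  assert (Htd : forall N, t (S N) <= t N).
  { intros N. rewrite Hts. pose proof (Ht0 N).
    assert (0 < / INR (S (S N))) by (apply Rinv_0_lt_compat, lt_0_INR; lia).
    assert (0 <= s * / INR (S (S N))) by nra. nra. }
  destruct (ex_finite_lim_seq_decr t 0 Htd Ht0) as [L HL].
  assert (HL0 : forall N, L <= t N) by (intros N; apply (is_lim_seq_decr_compare t L HL Htd)).
  assert (0 <= L).
  { apply (is_lim_seq_le (fun _ => 0) t 0 L); auto. apply is_lim_seq_const. }
  assert (L = 0) as ->.
  { destruct (Req_dec L 0) as [|HLn]; auto. exfalso. assert (HLp : 0 < L) by lra.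
    destruct (harmonic_unbounded (/ (s * L))) as [N HN].
    pose proof (Hth N). pose proof (HL0 N). assert (0 < s * L) by nra.
    assert (0 < / (s * L)) by now apply Rinv_0_lt_compat.
    assert (1 < s * L * harmonic N).
    { apply (Rmult_lt_compat_l (s * L)) in HN; auto. rewrite Rinv_r in HN; lra. }
    assert (0 <= s * harmonic N) by nra. nra. }
  apply is_series_lim. apply is_lim_seq_ext with (fun N => 1 - t N).
  - intros N. unfold t. ring.
  - replace (Finite 1) with (Finite (1 - 0)) by (f_equal; ring).
    apply is_lim_seq_minus'; auto using is_lim_seq_const.
Qed.

Lemma P_alpha_is_series (x y : Z) :
  is_series (fun n => c (S n) * Pk (S n) x y) (P_alpha alpha x y).
Proof.
  destruct (series_dominated (fun n => c (S n) * Pk (S n) x y) (fun n => c (S n)) 1 1) as [l Hl].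
  - intros n. pose proof (ck_pos n). pose proof (Pk_nonneg (S n) x y).
    pose proof (Pk_le_1 (S n) x y). split; nra.
  - apply is_series_ck.
  - unfold P_alpha. now rewrite (is_series_unique _ _ Hl).
Qed.

Lemma P_alpha_nonneg (x y : Z) : 0 <= P_alpha alpha x y.
Proof.
  eapply is_series_nonneg; [|apply P_alpha_is_series].
  intros n. apply Rmult_le_pos; [left; apply ck_pos|apply Pk_nonneg].
Qed.

(** The simple walk can go straight from [x] to [y] in [|x - y| >= 1] steps. The maximum principle
    uses this to reach the target in a single step. *)
Lemma P_alpha_pos (x y : Z) : x <> y -> 0 < P_alpha alpha x y.
Proof.
  intros Hxy.
  assert (Hn : exists n, 0 < Pk (S n) x y).
  { exists (Z.abs_nat (x - y) - 1)%nat.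
    rewrite Pk_shift. replace (S (Z.abs_nat (x - y) - 1)) with (Z.abs_nat (x - y)) by lia.
    destruct (Z_le_gt_dec 0 (x - y)).
    - replace (x - y)%Z with (Z.of_nat (Z.abs_nat (x - y))) at 2 by lia. apply Pk_pos.
    - rewrite <- Pk_opp.
      replace (- (x - y))%Z with (Z.of_nat (Z.abs_nat (x - y))) at 1 by lia. apply Pk_pos. }
  destruct Hn as [n Hn].
  assert (H : forall k, 0 <= c (S k) * Pk (S k) x y).
  { intros k. apply Rmult_le_pos; [left; apply ck_pos|apply Pk_nonneg]. }
  eapply Rlt_le_trans; [|apply (sum_le_series _ _ n H (P_alpha_is_series x y))].
  pose proof (Rmult_lt_0_compat _ _ (ck_pos n) Hn).
  destruct n as [|n]; cbn [sum_f_R0]; auto.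
  pose proof (cond_pos_sum _ n H). lra.
Qed.

(** Tonelli exchanges the sum over [y] with the series defining [P_alpha], so that only the
    functions [P^n f] remain to be computed. *)
Lemma P_alpha_apply (f : Z -> R) (x : Z) (S0 : R) :
  (forall y, 0 <= f y) -> is_series (fun n => c (S n) * Pn (S n) f x) S0 ->
  is_sumZ (fun y => P_alpha alpha x y * f y) S0.
Proof.
  intros Hf HS.
  eapply is_sumZ_ext; [|apply (tonelli_Z (fun n y => c (S n) * (Pk (S n) x y * f y))
    (fun n => c (S n) * Pn (S n) f x) S0)].
  - intros y. unfold P_alpha. rewrite <- Series_scal_r. apply Series_ext. intros n. simpl. ring.
  - intros n y. apply Rmult_le_pos; [left; apply ck_pos|].
    apply Rmult_le_pos; auto using Pk_nonneg.
  - intros n. apply is_sumZ_scal, Pn_sumZ.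
  - exact HS.
Qed.

Lemma P_alpha_stochastic (x : Z) : is_sumZ (P_alpha alpha x) 1.
Proof.
  assert (H : forall n z, Pn n (fun _ => 1) z = 1).
  { induction n as [|n IH]; intros z; simpl; rewrite ?IH; lra. }
  eapply is_sumZ_ext; [|apply (P_alpha_apply (fun _ => 1) x)].
  - intros y; simpl; ring.
  - intros; lra.
  - eapply is_series_congr; [|apply is_series_ck]. intros n. rewrite H. ring.
Qed.

Lemma Pn_green (n : nat) (x b : Z) :
  is_series (fun k => a k * Pk (n + k) x b) (Pn n (fun y => g (y - b)%Z) x).
Proof.
  revert x; induction n as [|n IH]; intros x; cbn [Pn].
  - apply green_is_series, half_alpha_bounds.
  - eapply is_series_congr; [|apply is_series_add; apply is_series_cmult; apply IH].
    intros k. simpl. ring.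
Qed.

Lemma green_nonneg (d : Z) : 0 <= g d.
Proof.
  pose proof (green_is_series s half_alpha_bounds d 0) as H. rewrite Z.sub_0_r in H.
  eapply is_series_nonneg; [|apply H].
  intros k. apply Rmult_le_pos; [apply green_coef_nonneg; pose proof half_alpha_bounds; lra|apply Pk_nonneg].
Qed.

(** The terms [c (j+1) a k P^(j+1+k)] are summed in two ways. Column [j] gives [c (j+1) P^(j+1) g];
    row [m = j + 1 + k] gives [a m P^m] by [convolution]. Row [0] is empty, so the term [a 0 P^0],
    the point mass at [b], is missing from [g]. *)
Lemma P_alpha_green (x b : Z) :
  is_sumZ (fun y => P_alpha alpha x y * g (y - b)%Z)
    (g (x - b)%Z - if Z.eq_dec x b then 1 else 0).
Proof.
  pose proof half_alpha_bounds as Hs.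
  apply P_alpha_apply; [intros; apply green_nonneg|].
  set (A := fun m j => if lt_dec j m then c (S j) * a (m - S j)%nat * Pk m x b else 0).
  set (r := fun m => if Nat.eq_dec m 0 then 0 else a m * Pk m x b).
  destruct (tonelli A r (g (x - b)%Z - if Z.eq_dec x b then 1 else 0)) as (col & Hcol & HS).
  - intros m j. unfold A. destruct (lt_dec j m); [|lra].
    apply Rmult_le_pos; [apply Rmult_le_pos|apply Pk_nonneg].
    + left; apply ck_pos.
    + apply green_coef_nonneg; lra.
  - intros m. unfold r. destruct m as [|m].
    + destruct (Nat.eq_dec 0 0); [|lia]. apply is_series_zero.
      intros j. unfold A. destruct (lt_dec j 0); [lia|auto].
    + destruct (Nat.eq_dec (S m) 0); [lia|].
      assert (E : a (S m) * Pk (S m) x b = sum_f_R0 (A (S m)) m).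
      { rewrite <- convolution, Rmult_comm, scal_sum. apply sum_eq. intros j Hj.
        unfold A. destruct (lt_dec j (S m)); [reflexivity|lia]. }
      rewrite E. apply is_series_finite. intros j Hj. unfold A.
      destruct (lt_dec j (S m)); [lia|auto].
  - assert (H := is_series_sub _ _ _ _ (green_is_series s Hs x b)
      (is_series_single (if Z.eq_dec x b then 1 else 0) 0)).
    eapply is_series_congr; [|exact H].
    intros m. unfold r.
    destruct m as [|m]; [simpl; ring|].
    destruct (Nat.eq_dec (S m) 0); [lia|ring].
  - eapply is_series_congr; [|apply HS].
    intros j. cbv beta. apply (is_series_eq (fun k => A (S j + k)%nat j)).
    + apply (is_series_drop (fun m => A m j)); [|apply Hcol].
      intros m Hm. unfold A. destruct (lt_dec j m); [lia|auto].
    + eapply is_series_congr; [|apply is_series_cmult, Pn_green].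
      intros k. unfold A. cbv beta. destruct (lt_dec j (S j + k)); [|lia].
      replace (S j + k - S j)%nat with k by lia. ring.
Qed.

End StableKernel.

(** * Hitting probabilities *)

Lemma is_sumZ_term (f : Z -> R) (l : R) (y : Z) :
  (forall z, 0 <= f z) -> is_sumZ f l -> f y <= l.
Proof.
  intros Hf Hl. eapply is_sumZ_le; [|apply (is_sumZ_single f y)|apply Hl].
  intros z. pose proof (Hf z). simpl. destruct (Z.eq_dec y z); lra.
Qed.

Lemma max_on_interval (f : Z -> R) (N : nat) :
  exists x, forall y, (Z.abs y <= Z.of_nat N)%Z -> f y <= f x.
Proof.
  induction N as [|N [x Hx]].
  - exists 0%Z. intros y Hy. replace y with 0%Z by lia. lra.
  - assert (Hext : forall u v, exists w, f u <= f w /\ f v <= f w).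
    { intros u v. destruct (Rle_dec (f u) (f v)); [exists v|exists u]; lra. }
    destruct (Hext (Z.of_nat (S N)) (- Z.of_nat (S N))%Z) as (u & Hu1 & Hu2).
    destruct (Hext x u) as (w & Hw1 & Hw2).
    exists w. intros y Hy.
    destruct (Z.eq_dec y (Z.of_nat (S N))) as [->|]; [lra|].
    destruct (Z.eq_dec y (- Z.of_nat (S N))) as [->|]; [lra|].
    pose proof (Hx y ltac:(lia)). lra.
Qed.

Section Hitting.

Variable p : Z -> Z -> R.
Hypothesis p_nonneg : forall x y, 0 <= p x y.
Hypothesis p_stochastic : forall x, is_sumZ (p x) 1.

Lemma kernel_summable (f : Z -> R) (M : R) (x : Z) :
  (forall y, 0 <= f y <= M) -> exists l, is_sumZ (fun y => p x y * f y) l.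
Proof.
  intros Hf. apply (is_sumZ_dominated _ (p x) M 1); auto.
  intros y. pose proof (Hf y). pose proof (p_nonneg x y). split; nra.
Qed.

Variable B : Z -> bool.

Lemma hit_target (n : nat) (x : Z) : B x = true -> hit p B n x = 1.
Proof. intros H. destruct n; simpl; now rewrite H. Qed.

Lemma hit_succ (n : nat) (x : Z) :
  B x = false -> hit p B (S n) x = sumZ (fun y => p x y * hit p B n y).
Proof. intros H. simpl. now rewrite H. Qed.

Lemma hit_bounds (n : nat) (x : Z) : 0 <= hit p B n x <= 1.
Proof.
  revert x; induction n as [|n IH]; intros x; destruct (B x) eqn:E;
    try (rewrite hit_target by auto; lra).
  - simpl. rewrite E. lra.
  - rewrite hit_succ by auto.
    destruct (kernel_summable (hit p B n) 1 x IH) as [l Hl].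
    rewrite (is_sumZ_unique _ _ Hl). split.
    + apply (is_sumZ_le (fun y => 0 * p x y) _ (0 * 1) _) in Hl; [lra| |now apply is_sumZ_scal].
      intros y. pose proof (IH y). pose proof (p_nonneg x y). nra.
    + apply (is_sumZ_le _ (p x) _ 1) in Hl; auto.
      intros y. pose proof (IH y). pose proof (p_nonneg x y). nra.
Qed.

Lemma hit_step (n : nat) (x : Z) :
  B x = false -> is_sumZ (fun y => p x y * hit p B n y) (hit p B (S n) x).
Proof.
  intros Hx. rewrite hit_succ by auto.
  destruct (kernel_summable (hit p B n) 1 x (hit_bounds n)) as [l Hl].
  now rewrite (is_sumZ_unique _ _ Hl).
Qed.

Lemma hit_incr (n : nat) (x : Z) : hit p B n x <= hit p B (S n) x.
Proof.
  revert x; induction n as [|n IH]; intros x; destruct (B x) eqn:E;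
    try (rewrite !hit_target by auto; lra).
  - simpl hit at 1. rewrite E. apply hit_bounds.
  - eapply is_sumZ_le; [|apply hit_step; auto|apply hit_step; auto].
    intros y. apply Rmult_le_compat_l; auto.
Qed.

Definition hit_prob (x : Z) : R := real (Lim_seq (fun n => hit p B n x)).

Notation h := hit_prob.

Lemma hit_prob_lim (x : Z) : is_lim_seq (fun n => hit p B n x) (h x).
Proof.
  destruct (ex_finite_lim_seq_incr (fun n => hit p B n x) 1) as [l Hl].
  - intros n. apply hit_incr.
  - intros n. apply hit_bounds.
  - unfold hit_prob. now rewrite (is_lim_seq_unique _ _ Hl).
Qed.

Lemma hit_le_hit_prob (n : nat) (x : Z) : hit p B n x <= h x.
Proof.
  apply (is_lim_seq_incr_compare (fun n => hit p B n x)).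
  - apply hit_prob_lim.
  - intros k. apply hit_incr.
Qed.

Lemma hit_prob_bounds (x : Z) : 0 <= h x <= 1.
Proof.
  split.
  - eapply Rle_trans; [apply (hit_bounds 0 x)|apply hit_le_hit_prob].
  - apply (is_lim_seq_le (fun n => hit p B n x) (fun _ => 1) (h x) 1).
    + intros n; apply hit_bounds.
    + apply hit_prob_lim.
    + apply is_lim_seq_const.
Qed.

Lemma hit_prob_target (x : Z) : B x = true -> h x = 1.
Proof.
  intros H. apply Rle_antisym; [apply hit_prob_bounds|].
  rewrite <- (hit_target 0 x H). apply hit_le_hit_prob.
Qed.

(** Fatou's lemma applied to the first-step identity [hit_step]. *)
Lemma hit_prob_superharmonic (x : Z) (T : R) :
  B x = false -> is_sumZ (fun y => p x y * h y) T -> T <= h x.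
Proof.
  intros Hx HT.
  apply (fatou_Z (fun n y => p x y * hit p B n y) (fun y => p x y * h y)
    (fun n => hit p B (S n) x)); auto.
  - intros n y. apply Rmult_le_pos; auto. apply hit_bounds.
  - intros n. now apply hit_step.
  - intros n. apply hit_le_hit_prob.
  - intros y. apply (is_lim_seq_scal_l (fun n => hit p B n y) (p x y) (h y)), hit_prob_lim.
Qed.

(* [1 - h <= (1 - eps) (1 - hit n)] propagates along [n]; in the limit
   [1 - h <= (1 - eps) (1 - h)]. *)
Lemma hit_prob_zero_one (eps : R) :
  0 < eps -> (forall x, eps <= h x) -> forall x, h x = 1.
Proof.
  intros Heps Hlow.
  assert (H : forall n x, 1 - h x <= (1 - eps) * (1 - hit p B n x)).
  { induction n as [|n IH]; intros x; destruct (B x) eqn:E;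
      try (rewrite hit_prob_target, hit_target by auto; lra).
    - simpl. rewrite E. pose proof (Hlow x). lra.
    - destruct (kernel_summable h 1 x hit_prob_bounds) as [T HT].
      pose proof (hit_prob_superharmonic x T E HT).
      assert (H1 := is_sumZ_minus _ _ _ _ (p_stochastic x) HT).
      assert (H2 := is_sumZ_scal _ (1 - eps) _
        (is_sumZ_minus _ _ _ _ (p_stochastic x) (hit_step n x E))).
      eapply is_sumZ_le in H2; [|clear H2|apply H1]; [lra|].
      intros y. pose proof (Rmult_le_compat_l (p x y) _ _ (p_nonneg x y) (IH y)). simpl. nra. }
  intros x.
  assert (1 - h x <= (1 - eps) * (1 - h x)).
  { apply (is_lim_seq_le (fun _ => 1 - h x) (fun n => (1 - eps) * (1 - hit p B n x))
      (1 - h x) ((1 - eps) * (1 - h x))); auto using is_lim_seq_const.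
    apply (is_lim_seq_scal_l _ (1 - eps) (1 - h x)), is_lim_seq_minus'; auto using is_lim_seq_const.
    apply hit_prob_lim. }
  pose proof (hit_prob_bounds x). nra.
Qed.

(** Maximum principle for [psi = phi - K h]. A positive value would yield a positive maximum,
    attained because [phi] vanishes at infinity and located off [B], where [psi] is subharmonic. But
    the walk moves from there to [b] with positive probability, and [psi b <= 0] pulls the average
    strictly below the maximum. *)
Lemma hit_prob_lower_bound (phi : Z -> R) (M K : R) (b : Z) :
  (forall x y, x <> y -> 0 < p x y) -> B b = true ->
  (forall x, 0 <= phi x <= M) ->
  (forall eps, 0 < eps -> exists N, forall x, (Z.of_nat N < Z.abs x)%Z -> phi x < eps) ->
  (forall x, B x = false -> is_sumZ (fun y => p x y * phi y) (phi x)) ->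
  0 <= K -> (forall x, B x = true -> phi x <= K) ->
  forall x, phi x <= K * h x.
Proof.
  intros Hpos Hb Hphi Hvan Hharm HK HphiK x0.
  destruct (Rle_lt_dec (phi x0) (K * h x0)) as [|Hx0]; auto. exfalso.
  set (psi := fun x => phi x - K * h x).
  assert (Hd : 0 < psi x0) by (unfold psi; lra).
  destruct (Hvan _ Hd) as [N HN].
  (* The interval contains [x0], and outside it [psi <= phi < psi x0], so the maximum over it is
     global. *)
  destruct (max_on_interval psi (N + Z.abs_nat x0)) as [z Hz].
  assert (Hz0 : psi x0 <= psi z) by (apply Hz; lia).
  assert (Hmax : forall y, psi y <= psi z).
  { intros y. destruct (Z_le_gt_dec (Z.abs y) (Z.of_nat (N + Z.abs_nat x0))); auto.
    pose proof (HN y ltac:(lia)). pose proof (hit_prob_bounds y).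
    assert (psi y <= phi y) by (unfold psi; nra). lra. }
  assert (HBpsi : forall y, B y = true -> psi y <= 0).
  { intros y Hy. unfold psi. rewrite hit_prob_target by auto. pose proof (HphiK y Hy). lra. }
  destruct (B z) eqn:Ez; [pose proof (HBpsi z Ez); lra|].
  destruct (kernel_summable h 1 z hit_prob_bounds) as [T HT].
  pose proof (hit_prob_superharmonic z T Ez HT).
  assert (H1 := is_sumZ_minus _ _ _ _ (is_sumZ_scal _ (psi z) _ (p_stochastic z))
    (is_sumZ_minus _ _ _ _ (Hharm z Ez) (is_sumZ_scal _ K _ HT))).
  apply (is_sumZ_ext _ (fun y => p z y * (psi z - psi y))) in H1.
  - apply (is_sumZ_term _ _ b) in H1.
    + pose proof (HBpsi b Hb).
      assert (0 < p z b) by (apply Hpos; congruence).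
      assert (psi z * 1 - (phi z - K * T) <= 0) by (unfold psi; nra).
      assert (0 < p z b * (psi z - psi b)) by (apply Rmult_lt_0_compat; lra). lra.
    + intros y. apply Rmult_le_pos; auto. pose proof (Hmax y). lra.
  - intros y. unfold psi. ring.
Qed.

End Hitting.

(** * Potentials and massive sets *)

(** [T] plays the role of a discrete antiderivative of [F]; the bound does not depend on the length
    [N] of the sum. *)
Lemma sum_below_telescope (F T : nat -> R) (K N : nat) :
  (forall i, 0 <= F i <= T (S i) - T i) ->
  sum_f_R0 (fun i => if lt_dec i K then F i else 0) N <= T K - T 0%nat.
Proof.
  intros H.
  assert (HT : forall i j, (i <= j)%nat -> T i <= T j).
  { intros i j Hij; induction Hij as [|j Hij IH]; [lra|]. pose proof (H j). lra. }
  assert (Hsum : sum_f_R0 (fun i => if lt_dec i K then F i else 0) N <= T (Nat.min (S N) K) - T 0%nat).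
  { induction N as [|N IH]; cbn [sum_f_R0].
    - destruct (lt_dec 0 K).
      + replace (Nat.min 1 K) with 1%nat by lia. apply H.
      + replace K with 0%nat by lia. simpl. lra.
    - destruct (lt_dec (S N) K).
      + replace (Nat.min (S (S N)) K) with (S (S N)) by lia.
        replace (Nat.min (S N) K) with (S N) in IH by lia. pose proof (H (S N)). lra.
      + replace (Nat.min (S (S N)) K) with K by lia.
        replace (Nat.min (S N) K) with K in IH by lia. lra. }
  pose proof (HT (Nat.min (S N) K) K ltac:(lia)). lra.
Qed.

Section GreenEstimates.

Variable alpha : R.
Hypothesis Halpha : 0 < alpha < 1.

Let s : R := alpha / 2.

Notation g := (green s).

Let gn (n : nat) : R := g (Z.of_nat n).

Let Hs : 0 < s < / 2.
Proof. unfold s. lra. Qed.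

Lemma gn_rec (n : nat) : (INR n + 1 - s) * gn (S n) = (INR n + s) * gn n.
Proof.
  unfold gn. rewrite INR_IZR_INZ, Nat2Z.inj_succ. apply green_rec, Hs.
Qed.

Lemma gn_pos (n : nat) : 0 < gn n.
Proof.
  induction n as [|n IH].
  - pose proof (green_is_series s Hs 0 0) as H. change (0 - 0)%Z with 0%Z in H.
    eapply Rlt_le_trans; [|apply (fun Hk => sum_le_series _ _ 0 Hk H)].
    + simpl. lra.
    + intros k. apply Rmult_le_pos; [apply green_coef_nonneg; lra|apply Pk_nonneg].
  - pose proof (gn_rec n). pose proof (pos_INR n).
    apply (Rmult_lt_reg_l (INR n + 1 - s)); [lra|]. rewrite H, Rmult_0_r.
    apply Rmult_lt_0_compat; lra.
Qed.

Lemma green_abs (d : Z) : g d = gn (Z.abs_nat d).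
Proof.
  unfold gn. destruct (Z_le_gt_dec 0 d).
  - f_equal. lia.
  - rewrite <- green_opp. f_equal. lia.
Qed.

Lemma green_pos (d : Z) : 0 < g d.
Proof. rewrite green_abs. apply gn_pos. Qed.

Lemma gn_decr (m n : nat) : (n <= m)%nat -> gn m <= gn n.
Proof.
  intros H; induction H as [|m H IH]; [lra|].
  eapply Rle_trans; [|apply IH].
  pose proof (gn_rec m). pose proof (gn_pos m). pose proof (pos_INR m).
  apply (Rmult_le_reg_l (INR m + 1 - s)); [lra|]. rewrite H0.
  apply Rmult_le_compat_r; lra.
Qed.

(** By the recurrence [(n - s) gn n] is nondecreasing while [gn] is nonincreasing; the constant
    comes from [2 m - s <= 4 (m - s)]. *)
Lemma gn_doubling (m n : nat) : (1 <= m)%nat -> (n <= 2 * m)%nat -> gn m <= 4 * gn n.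
Proof.
  intros Hm Hn.
  assert (H : forall k, (m <= k)%nat -> (INR m - s) * gn m <= (INR k - s) * gn k).
  { intros k Hk; induction Hk as [|k Hk IH]; [lra|].
    eapply Rle_trans; [apply IH|]. rewrite S_INR, gn_rec. pose proof (gn_pos k). nra. }
  specialize (H (2 * m)%nat ltac:(lia)). rewrite mult_INR in H. simpl (INR 2) in H.
  pose proof (gn_decr (2 * m) n Hn). pose proof (gn_pos (2 * m)).
  apply (le_INR 1) in Hm. simpl (INR 1) in Hm.
  apply (Rmult_le_reg_l (INR m - s)); [lra|]. nra.
Qed.

(** The exact increment of [1 / gn] is [(1 - 2 s) / ((n + s) gn n)]. Thus [1 / gn] bounds sums of
    [1 / (n gn n)], and it diverges at least like a harmonic sum, which gives [gn_vanishes]. *)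
Lemma gn_inv_step (n : nat) :
  (1 - 2 * s) / ((INR n + 1) * gn n) <= / gn (S n) - / gn n.
Proof.
  pose proof (gn_rec n) as H. pose proof (gn_pos n). pose proof (gn_pos (S n)). pose proof (pos_INR n).
  assert (0 < INR n + s) by lra.
  replace (/ gn (S n)) with ((INR n + 1 - s) / ((INR n + s) * gn n)) by (rewrite <- H; field; lra).
  replace ((INR n + 1 - s) / ((INR n + s) * gn n) - / gn n) with ((1 - 2 * s) / ((INR n + s) * gn n))
    by (field; lra).
  apply Rmult_le_compat_l; [lra|]. apply Rinv_le_contravar; [nra|].
  apply Rmult_le_compat_r; lra.
Qed.

Lemma gn_vanishes (eps : R) : 0 < eps -> exists N, forall n, (N <= n)%nat -> gn n < eps.
Proof.
  intros Heps. pose proof (gn_pos 0) as H0.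
  assert (H : forall n, (1 - 2 * s) / gn 0 * harmonic n <= / gn (S n)).
  { intros n. unfold harmonic. rewrite scal_sum.
    assert (Hst : forall k, / INR (S k) * ((1 - 2 * s) / gn 0) <= / gn (S k) - / gn k).
    { intros k. eapply Rle_trans; [|apply gn_inv_step]. rewrite S_INR.
      pose proof (pos_INR k). pose proof (gn_pos k). pose proof (gn_decr k 0 ltac:(lia)).
      replace (/ (INR k + 1) * ((1 - 2 * s) / gn 0)) with ((1 - 2 * s) / ((INR k + 1) * gn 0))
        by (field; lra).
      apply Rmult_le_compat_l; [lra|]. apply Rinv_le_contravar; [nra|].
      apply Rmult_le_compat_l; lra. }
    induction n as [|n IH]; cbn [sum_f_R0].
    - pose proof (Hst 0%nat). assert (0 < / gn 0) by now apply Rinv_0_lt_compat. lra.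
    - pose proof (Hst (S n)). lra. }
  assert (Hk : 0 < (1 - 2 * s) / gn 0) by (apply Rdiv_lt_0_compat; lra).
  destruct (harmonic_unbounded (/ eps / ((1 - 2 * s) / gn 0))) as [N HN].
  exists (S N). intros n Hn.
  apply Rle_lt_trans with (gn (S N)); [now apply gn_decr|].
  apply Rlt_div_l in HN; [|lra]. specialize (H N). pose proof (gn_pos (S N)).
  rewrite <- (Rinv_inv eps), <- (Rinv_inv (gn (S N))).
  assert (0 < / eps) by now apply Rinv_0_lt_compat.
  apply Rinv_lt_contravar; [|lra]. apply Rmult_lt_0_compat; lra.
Qed.

(* Indexed by [b = i + 1], so that the point [0] never carries a weight. *)
Definition potential (v : nat -> R) (N : nat) (x : Z) : R :=
  sum_f_R0 (fun i => v i * (g (x - Z.of_nat (S i)) / (INR (S i) * gn (S i)))) N.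

Definition mass (v : nat -> R) (N : nat) : R := sum_f_R0 (fun i => v i / INR (S i)) N.

Let weight_pos (i : nat) : 0 < INR (S i) * gn (S i).
Proof. apply Rmult_lt_0_compat; [apply lt_0_INR; lia|apply gn_pos]. Qed.

(** A weighted point [b] has [|x - b| <= 2 b], so [gn_doubling] gives [g b <= 4 g (x - b)]. *)
Lemma potential_lower (v : nat -> R) (N : nat) (x : Z) :
  (forall i, 0 <= v i) -> (forall i, v i <> 0 -> (Z.abs x <= Z.of_nat (S i))%Z) ->
  mass v N / 4 <= potential v N x.
Proof.
  intros Hv Hx. unfold mass, potential, Rdiv. rewrite Rmult_comm, scal_sum.
  apply sum_Rle. intros i _. pose proof (weight_pos i) as Hw. pose proof (gn_pos (S i)).
  destruct (Req_dec (v i) 0) as [->|Hi]; [lra|].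
  specialize (Hx i Hi). rewrite Rmult_assoc. apply Rmult_le_compat_l; auto.
  rewrite green_abs.
  pose proof (gn_doubling (S i) (Z.abs_nat (x - Z.of_nat (S i))) ltac:(lia) ltac:(lia)) as Hd.
  assert (0 < INR (S i)) by (apply lt_0_INR; lia).
  apply (Rmult_le_reg_r (INR (S i) * gn (S i))); auto.
  field_simplify; [|lra|lra]. lra.
Qed.

(* The three terms majorize the points [b = i + 1] with [b >= 2 y],
   [2 b <= y] and [y < 2 b < 4 y] respectively. *)
Lemma potential_term_upper (y i : nat) :
  (1 <= y)%nat ->
  g (Z.of_nat y - Z.of_nat (S i)) / (INR (S i) * gn (S i)) <=
  4 / INR (S i) +
  4 * gn y * (if lt_dec i y then / (INR (S i) * gn (S i)) else 0) +
  8 / (INR y * gn y) * (if lt_dec i (2 * y) then g (Z.of_nat (S i) - Z.of_nat y) else 0).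
Proof.
  intros Hy. pose proof (weight_pos i) as Hw. pose proof (gn_pos (S i)) as Hgi.
  pose proof (gn_pos y) as Hgy. assert (Hi : 0 < INR (S i)) by (apply lt_0_INR; lia).
  assert (Hy' : 0 < INR y) by (apply lt_0_INR; lia).
  assert (H1 : 0 < 4 / INR (S i)) by (apply Rdiv_lt_0_compat; lra).
  assert (H2 : 0 <= 4 * gn y * (if lt_dec i y then / (INR (S i) * gn (S i)) else 0)).
  { apply Rmult_le_pos; [lra|]. destruct (lt_dec i y); [|lra]. left. now apply Rinv_0_lt_compat. }
  assert (H8 : 0 < 8 / (INR y * gn y)).
  { apply Rdiv_lt_0_compat; [lra|]. now apply Rmult_lt_0_compat. }
  assert (H3 : 0 <= 8 / (INR y * gn y) *
    (if lt_dec i (2 * y) then g (Z.of_nat (S i) - Z.of_nat y) else 0)).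
  { apply Rmult_le_pos; [lra|]. destruct (lt_dec i (2 * y)); [|lra]. left. apply green_pos. }
  rewrite <- (green_opp s (Z.of_nat y - Z.of_nat (S i))).
  replace (- (Z.of_nat y - Z.of_nat (S i)))%Z with (Z.of_nat (S i) - Z.of_nat y)%Z by lia.
  destruct (le_dec (2 * y) (S i)) as [Hc|Hc]; [|destruct (le_dec (2 * S i) y) as [Hc'|Hc']].
  - apply Rle_trans with (4 / INR (S i)); [|lra].
    rewrite green_abs.
    pose proof (gn_doubling (Z.abs_nat (Z.of_nat (S i) - Z.of_nat y)) (S i) ltac:(lia) ltac:(lia)).
    apply Rle_div_l; [lra|]. replace (4 / INR (S i) * (INR (S i) * gn (S i))) with (4 * gn (S i))
      by (field; lra). lra.
  - destruct (lt_dec i y); [|lia].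
    apply Rle_trans with (4 * gn y * / (INR (S i) * gn (S i))); [|lra].
    apply Rmult_le_compat_r; [left; now apply Rinv_0_lt_compat|].
    rewrite green_abs. apply gn_doubling; lia.
  - destruct (lt_dec i (2 * y)); [|lia].
    apply Rle_trans with (8 / (INR y * gn y) * g (Z.of_nat (S i) - Z.of_nat y)); [|lra].
    unfold Rdiv at 1. rewrite (Rmult_comm (g _)).
    apply Rmult_le_compat_r; [left; apply green_pos|].
    (* From [gn y <= 4 gn b] and [y <= 2 b] follows [y gn y <= 8 b gn b], the source of the constant
       8. *)
    pose proof (gn_doubling y (S i) Hy ltac:(lia)) as Hd.
    assert (Hyi : INR y <= 2 * INR (S i)).
    { replace (2 * INR (S i)) with (INR (2 * S i)) by (rewrite mult_INR; simpl; ring).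
      apply le_INR. lia. }
    apply Rle_div_r; [nra|]. rewrite Rmult_comm. apply Rle_div_l; [nra|].
    nra.
Qed.

(** The first majorant of [potential_term_upper] sums to [4 mass]. In the other two [v] is replaced
    by 1, and their sums telescope to constants independent of [y] and [N]. *)
Lemma potential_upper (v : nat -> R) (N y : nat) :
  (forall i, 0 <= v i <= 1) -> (1 <= y)%nat ->
  potential v N (Z.of_nat y) <= 4 * mass v N + (32 / (1 - 2 * s) + 8 / s).
Proof.
  intros Hv Hy. pose proof (gn_pos y) as Hgy.
  assert (Hy' : 1 <= INR y) by (apply (le_INR 1) in Hy; exact Hy).
  set (F2 := fun i => / (INR (S i) * gn (S i))).
  set (F3 := fun i => g (Z.of_nat (S i) - Z.of_nat y)).
  assert (Hsum2 : sum_f_R0 (fun i => if lt_dec i y then F2 i else 0) N <= 8 / (1 - 2 * s) / gn y).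
  (* An antiderivative from [gn_inv_step]; the factor 2 absorbs [b + 1 <= 2 b]. *)
  { set (T := fun i => 2 / (1 - 2 * s) * / gn (S i)).
    eapply Rle_trans; [apply (sum_below_telescope F2 T)|].
    - intros i. unfold F2, T. pose proof (weight_pos i). pose proof (gn_pos (S i)).
      split; [left; now apply Rinv_0_lt_compat|].
      rewrite <- Rmult_minus_distr_l.
      apply Rle_trans with (2 / (1 - 2 * s) * ((1 - 2 * s) / ((INR (S i) + 1) * gn (S i)))).
      + assert (1 <= INR (S i)) by (apply (le_INR 1); lia).
        replace (2 / (1 - 2 * s) * ((1 - 2 * s) / ((INR (S i) + 1) * gn (S i))))
          with (2 / ((INR (S i) + 1) * gn (S i))) by (field; lra).
        apply Rle_div_r; [nra|]. rewrite Rmult_comm. apply Rle_div_l; [nra|]. nra.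
      + apply Rmult_le_compat_l; [|apply gn_inv_step]. apply Rdiv_le_0_compat; lra.
    - unfold T. pose proof (gn_doubling y (S y) Hy ltac:(lia)) as Hd.
      pose proof (gn_pos (S y)). pose proof (gn_pos 1).
      assert (0 < 2 / (1 - 2 * s)) by (apply Rdiv_lt_0_compat; lra).
      assert (0 < / gn 1) by now apply Rinv_0_lt_compat.
      assert (/ gn (S y) <= 4 / gn y).
      { apply Rle_div_r; auto. rewrite Rmult_comm. apply Rle_div_l; lra. }
      replace (8 / (1 - 2 * s) / gn y) with (2 / (1 - 2 * s) * (4 / gn y)) by (field; lra). nra. }
  assert (Hsum3 : sum_f_R0 (fun i => if lt_dec i (2 * y) then F3 i else 0) N <= INR y * gn y / s).
  (* An exact antiderivative: [green_rec] gives [(d + 1 - s) g (d+1) - (d - s) g d = 2 s g d]. The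
     boundary values at [b = 2 y + 1] and [b = 1] combine to exactly [y gn y / s]. *)
  { set (T := fun i => (INR (S i) - INR y - s) / (2 * s) * g (Z.of_nat (S i) - Z.of_nat y)).
    eapply Rle_trans; [apply (sum_below_telescope F3 T)|].
    - intros i. unfold F3, T. split; [left; apply green_pos|]. right.
      pose proof (green_rec s Hs (Z.of_nat (S i) - Z.of_nat y)) as Hr.
      replace (Z.of_nat (S i) - Z.of_nat y + 1)%Z with (Z.of_nat (S (S i)) - Z.of_nat y)%Z in Hr by lia.
      rewrite minus_IZR, <- !INR_IZR_INZ in Hr. rewrite (S_INR (S i)).
      apply (Rmult_eq_reg_l (2 * s)); [|lra].
      replace (2 * s * ((INR (S i) + 1 - INR y - s) / (2 * s) * g (Z.of_nat (S (S i)) - Z.of_nat y)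
        - (INR (S i) - INR y - s) / (2 * s) * g (Z.of_nat (S i) - Z.of_nat y)))
        with ((INR (S i) - INR y + 1 - s) * g (Z.of_nat (S (S i)) - Z.of_nat y)
        - (INR (S i) - INR y - s) * g (Z.of_nat (S i) - Z.of_nat y)) by (field; lra).
      rewrite Hr. ring.
    - unfold T. rewrite !green_abs.
      replace (Z.abs_nat (Z.of_nat (S (2 * y)) - Z.of_nat y)) with (S y) by lia.
      replace (Z.abs_nat (Z.of_nat 1 - Z.of_nat y)) with (y - 1)%nat by lia.
      pose proof (gn_rec y) as H1. pose proof (gn_rec (y - 1)) as H2.
      replace (S (y - 1)) with y in H2 by lia. rewrite minus_INR in H2 by lia.
      rewrite S_INR, mult_INR. simpl (INR 1) in *. simpl (INR 2).
      right. apply (Rmult_eq_reg_l (2 * s)); [|lra].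
      transitivity ((INR y + 1 - s) * gn (S y) + (INR y - 1 + s) * gn (y - 1)); [field; lra|].
      rewrite <- H2, H1. field. lra. }
  apply Rle_trans with (4 * mass v N
    + 4 * gn y * sum_f_R0 (fun i => if lt_dec i y then F2 i else 0) N
    + 8 / (INR y * gn y) * sum_f_R0 (fun i => if lt_dec i (2 * y) then F3 i else 0) N).
  - unfold potential, mass. rewrite !scal_sum, <- !sum_plus. apply sum_Rle. intros i _.
    pose proof (potential_term_upper y i Hy) as H. pose proof (Hv i) as Hvi.
    assert (Hi : 0 < INR (S i)) by (apply lt_0_INR; lia).
    fold (F2 i) in H. fold (F3 i) in H.
    assert (H2 : 0 <= 4 * gn y * (if lt_dec i y then F2 i else 0)).
    { apply Rmult_le_pos; [lra|]. destruct (lt_dec i y); [|lra]. left.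
      apply Rinv_0_lt_compat, weight_pos. }
    assert (H3 : 0 <= 8 / (INR y * gn y) * (if lt_dec i (2 * y) then F3 i else 0)).
    { apply Rmult_le_pos; [apply Rdiv_le_0_compat; nra|].
      destruct (lt_dec i (2 * y)); [|lra]. left. apply green_pos. }
    apply (Rmult_le_compat_l (v i)) in H; [|lra].
    replace (v i / INR (S i) * 4) with (v i * (4 / INR (S i))) by (field; lra).
    nra.
  - assert (4 * gn y * sum_f_R0 (fun i => if lt_dec i y then F2 i else 0) N <= 32 / (1 - 2 * s)).
    { apply (Rmult_le_compat_l (4 * gn y)) in Hsum2; [|lra].
      replace (4 * gn y * (8 / (1 - 2 * s) / gn y)) with (32 / (1 - 2 * s)) in Hsum2 by (field; lra).
      exact Hsum2. }
    assert (8 / (INR y * gn y) * sum_f_R0 (fun i => if lt_dec i (2 * y) then F3 i else 0) N <= 8 / s).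
    { apply (Rmult_le_compat_l (8 / (INR y * gn y))) in Hsum3; [|apply Rdiv_le_0_compat; nra].
      replace (8 / (INR y * gn y) * (INR y * gn y / s)) with (8 / s) in Hsum3 by (field; lra).
      exact Hsum3. }
    lra.
Qed.

Lemma potential_vanishes (v : nat -> R) (N : nat) (eps : R) :
  (forall i, 0 <= v i) -> 0 < eps ->
  exists K, forall x, (Z.of_nat K < Z.abs x)%Z -> potential v N x < eps.
Proof.
  intros Hv. revert eps. unfold potential.
  assert (Hone : forall i eps, 0 < eps -> exists K, forall x, (Z.of_nat K < Z.abs x)%Z ->
    v i * (g (x - Z.of_nat (S i)) / (INR (S i) * gn (S i))) < eps).
  { intros i eps Heps. set (w := INR (S i) * gn (S i)).
    assert (Hw : 0 < w) by apply weight_pos.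
    pose proof (Hv i).
    (* The summand 1 keeps the denominator positive when [v i = 0]. *)
    destruct (gn_vanishes (eps * w / (v i + 1))) as [K HK].
    { apply Rdiv_lt_0_compat; [nra|lra]. }
    exists (K + S i)%nat. intros x Hx. rewrite green_abs.
    pose proof (HK (Z.abs_nat (x - Z.of_nat (S i))) ltac:(lia)) as H'.
    pose proof (gn_pos (Z.abs_nat (x - Z.of_nat (S i)))).
    apply Rlt_div_r in H'; [|lra].
    apply (Rmult_lt_reg_r w); auto.
    replace (v i * (gn (Z.abs_nat (x - Z.of_nat (S i))) / w) * w) with
      (v i * gn (Z.abs_nat (x - Z.of_nat (S i)))) by (field; lra).
    nra. }
  induction N as [|N IH]; intros eps Heps; cbn [sum_f_R0].
  - now apply Hone.
  - destruct (IH (eps / 2) ltac:(lra)) as [K1 H1].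
    destruct (Hone (S N) (eps / 2) ltac:(lra)) as [K2 H2].
    exists (Nat.max K1 K2). intros x Hx.
    pose proof (H1 x ltac:(lia)). pose proof (H2 x ltac:(lia)). lra.
Qed.

Lemma potential_bounds (v : nat -> R) (N : nat) :
  (forall i, 0 <= v i) -> exists M, forall x, 0 <= potential v N x <= M.
Proof.
  intros Hv.
  exists (sum_f_R0 (fun i => v i * (gn 0 / (INR (S i) * gn (S i)))) N).
  intros x. unfold potential. split.
  - apply cond_pos_sum. intros i. apply Rmult_le_pos; auto. left.
    apply Rdiv_lt_0_compat; [apply green_pos|apply weight_pos].
  - apply sum_Rle. intros i _. apply Rmult_le_compat_l; auto.
    apply Rmult_le_compat_r; [left; apply Rinv_0_lt_compat, weight_pos|].
    rewrite green_abs. apply gn_decr. lia.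
Qed.

(** The point mass in [P_alpha_green] contributes only when [x] is the point of index [i], and then
    its coefficient [v i] is zero. *)
Lemma potential_harmonic (v : nat -> R) (N : nat) (x : Z) :
  (forall i, x = Z.of_nat (S i) -> v i = 0) ->
  is_sumZ (fun y => P_alpha alpha x y * potential v N y) (potential v N x).
Proof.
  intros Hx. unfold potential.
  assert (Hone : forall i, is_sumZ (fun y => P_alpha alpha x y *
      (v i * (g (y - Z.of_nat (S i)) / (INR (S i) * gn (S i)))))
    (v i * (g (x - Z.of_nat (S i)) / (INR (S i) * gn (S i))))).
  { intros i. pose proof (is_sumZ_scal _ (v i / (INR (S i) * gn (S i))) _
      (P_alpha_green alpha Halpha x (Z.of_nat (S i)))) as H. fold s in H.
    replace (v i * (g (x - Z.of_nat (S i)) / (INR (S i) * gn (S i)))) with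
      (v i / (INR (S i) * gn (S i)) *
        (g (x - Z.of_nat (S i)) - (if Z.eq_dec x (Z.of_nat (S i)) then 1 else 0))).
    - eapply is_sumZ_ext; [|apply H]. intros y. simpl. unfold Rdiv. ring.
    - destruct (Z.eq_dec x (Z.of_nat (S i))) as [E|E]; [rewrite (Hx i E)|]; unfold Rdiv; ring. }
  induction N as [|N IH]; cbn [sum_f_R0]; [apply Hone|].
  eapply is_sumZ_ext; [|apply (is_sumZ_plus _ _ _ _ IH (Hone (S N)))].
  intros y. simpl. ring.
Qed.

End GreenEstimates.

(** * Massiveness from divergent reciprocals *)

Definition indicator (B : Z -> bool) (n : nat) : R := if B (Z.of_nat n) then 1 else 0.

Theorem massive_of_divergent_reciprocals (alpha : R) (B : Z -> bool) :
  0 < alpha < 1 -> (forall z, B z = true -> (0 < z)%Z) ->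
  (forall C, exists N, C < sum_f_R0 (fun i => indicator B (S i) / INR (S i)) N) ->
  massive (P_alpha alpha) B.
Proof.
  intros Halpha HBpos Hdiv.
  set (C0 := 32 / (1 - 2 * (alpha / 2)) + 8 / (alpha / 2)).
  assert (HC0 : 0 <= C0).
  { apply Rplus_le_le_0_compat; apply Rdiv_le_0_compat; lra. }
  assert (Hb : exists b, B b = true).
  { destruct (Hdiv 0) as [N HN]. apply NNPP. intros Hno.
    assert (sum_f_R0 (fun i => indicator B (S i) / INR (S i)) N <= 0); [|lra].
    rewrite <- (sum_eq_R0 (fun _ => 0) N) by auto.
    apply sum_Rle. intros i _. unfold indicator.
    destruct (B (Z.of_nat (S i))) eqn:E; [exfalso; eauto|]. unfold Rdiv. lra. }
  destruct Hb as [b Hb].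
  assert (Hlow : forall x, / 32 <= hit_prob (P_alpha alpha) B x).
  { intros x. set (L := Z.abs_nat x).
    set (v := fun i => if lt_dec i L then 0 else indicator B (S i)).
    assert (Hv : forall i, 0 <= v i <= 1).
    { intros i. unfold v, indicator. destruct (lt_dec i L); [lra|].
      destruct (B (Z.of_nat (S i))); lra. }
    assert (Hv0 : forall i, 0 <= v i) by apply Hv.
    assert (Hmass : exists N, C0 + 1 < mass v N).
    (* Discarding the points [b <= L] costs at most [L], since each reciprocal is at most 1. *)
    { destruct (Hdiv (C0 + 1 + INR L)) as [N HN]. exists N.
      assert (Hrest : sum_f_R0 (fun i => if lt_dec i L then 1 else 0) N <= INR L - INR 0).
      { apply (sum_below_telescope (fun _ => 1)). intros i. rewrite S_INR. lra. }
      simpl (INR 0) in Hrest.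
      assert (sum_f_R0 (fun i => indicator B (S i) / INR (S i)) N <=
        mass v N + sum_f_R0 (fun i => if lt_dec i L then 1 else 0) N); [|lra].
      unfold mass. rewrite <- sum_plus. apply sum_Rle. intros i _. unfold v.
      destruct (lt_dec i L); [|lra].
      assert (indicator B (S i) <= 1) by (unfold indicator; destruct (B (Z.of_nat (S i))); lra).
      assert (1 <= INR (S i)) by (apply (le_INR 1); lia).
      unfold Rdiv at 2. rewrite Rmult_0_l, Rplus_0_l. apply Rle_div_l; lra. }
    destruct Hmass as [N HN].
    destruct (potential_bounds alpha Halpha v N Hv0) as [M HM].
    assert (H : potential alpha v N x <= (4 * mass v N + C0) * hit_prob (P_alpha alpha) B x).
    { apply (hit_prob_lower_bound (P_alpha alpha)) with (M := M) (b := b); auto.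
      - apply P_alpha_nonneg; auto.
      - apply P_alpha_stochastic; auto.
      - apply P_alpha_pos; auto.
      - intros eps Heps. now apply potential_vanishes.
      - intros z Hz. apply potential_harmonic; auto. intros i ->. unfold v, indicator.
        rewrite Hz. now destruct (lt_dec i L).
      - lra.
      - intros z Hz. apply HBpos in Hz. rewrite <- (Z2Nat.id z) by lia.
        apply potential_upper; auto. lia. }
    (* As [0 <= C0 < mass], the ratio of [mass / 4] to [4 mass + C0] exceeds [1/20], more than the
       required [1/32]. *)
    pose proof (potential_lower alpha Halpha v N x Hv0) as Hp.
    assert (mass v N / 4 <= potential alpha v N x).
    { apply Hp. intros i Hi. unfold v in Hi. destruct (lt_dec i L); [lra|]. lia. }
    pose proof (hit_prob_bounds (P_alpha alpha) (P_alpha_nonneg alpha Halpha)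
      (P_alpha_stochastic alpha Halpha) B x). nra. }
  intros x.
  rewrite <- (hit_prob_zero_one (P_alpha alpha) (P_alpha_nonneg alpha Halpha)
    (P_alpha_stochastic alpha Halpha) B (/ 32) ltac:(lra) Hlow x).
  apply hit_prob_lim; [now apply P_alpha_nonneg|now apply P_alpha_stochastic].
Qed.

(** * Reciprocals of the primes *)

Lemma exists_prime_divisor (n : Z) : (1 < n)%Z -> exists q, prime q /\ (q | n)%Z.
Proof.
  intros Hn. assert (Hn0 : (0 <= n)%Z) by lia. revert n Hn0 Hn.
  apply (Z_lt_induction (fun n => (1 < n)%Z -> exists q, prime q /\ (q | n)%Z)).
  intros n IH Hn. destruct (prime_dec n) as [Hp|Hp].
  - exists n. split; auto. apply Z.divide_refl.
  - destruct (not_prime_divide n Hn Hp) as (m & Hm & Hmn).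
    destruct (IH m ltac:(lia) ltac:(lia)) as (q & Hq & Hqm).
    exists q. split; auto. now apply Z.divide_trans with m.
Qed.

Definition smooth (m n : nat) : Prop :=
  forall q, prime q -> (q | Z.of_nat n)%Z -> (q <= Z.of_nat m)%Z.

Definition smooth_ind (m n : nat) : R :=
  if excluded_middle_informative (smooth m n) then 1 else 0.

(* The term [n = 0] vanishes because [/ 0 = 0]. *)
Definition smooth_sum (m N : nat) : R := sum_f_R0 (fun n => smooth_ind m n * / INR n) N.

Lemma smooth_ind_bounds (m n : nat) : 0 <= smooth_ind m n <= 1.
Proof. unfold smooth_ind. destruct excluded_middle_informative; lra. Qed.

Lemma inv_INR_nonneg (n : nat) : 0 <= / INR n.
Proof.
  destruct n as [|n]; [simpl; rewrite Rinv_0; lra|].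
  left. apply Rinv_0_lt_compat, lt_0_INR. lia.
Qed.

(** No prime is at most 0, so only [n = 1] contributes. *)
Lemma smooth_sum_zero (N : nat) : smooth_sum 0 N <= 1.
Proof.
  unfold smooth_sum.
  assert (H : forall n, (n <> 1)%nat -> smooth_ind 0 n * / INR n = 0).
  { intros n Hn. destruct n as [|n]; [simpl; rewrite Rinv_0; ring|].
    unfold smooth_ind. destruct excluded_middle_informative as [Hsm|]; [|ring]. exfalso.
    destruct (exists_prime_divisor (Z.of_nat (S n)) ltac:(lia)) as (q & Hq & Hqn).
    pose proof (Hsm q Hq Hqn). apply prime_ge_2 in Hq. lia. }
  eapply Rle_trans.
  - apply (sum_le_series _ 1 N).
    + intros n. apply Rmult_le_pos; [apply smooth_ind_bounds|apply inv_INR_nonneg].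
    + eapply is_series_ext; [|apply (is_series_single 1 1)].
      intros n. simpl. destruct (Nat.eq_dec n 1) as [->|Hn]; [|now rewrite H].
      unfold smooth_ind. destruct excluded_middle_informative as [|Hsm].
      * simpl. now rewrite Rinv_1, Rmult_1_l.
      * exfalso. apply Hsm. intros q Hq Hq1. apply prime_ge_2 in Hq.
        apply Z.divide_1_r in Hq1. lia.
  - lra.
Qed.

Lemma sum_multiples_le (F : nat -> R) (p N : nat) :
  (1 <= p)%nat -> (forall n, 0 <= F n) ->
  sum_f_R0 (fun n => if Nat.eq_dec (n mod p) 0 then F n else 0) N <=
  sum_f_R0 (fun k => F (p * k)%nat) N.
Proof.
  intros Hp HF.
  assert (Hmono : forall a b, (a <= b)%nat ->
    sum_f_R0 (fun k => F (p * k)%nat) a <= sum_f_R0 (fun k => F (p * k)%nat) b).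
  { intros a b Hab; induction Hab as [|b Hab IH]; [lra|]. cbn [sum_f_R0].
    pose proof (HF (p * S b)%nat). lra. }
  apply Rle_trans with (sum_f_R0 (fun k => F (p * k)%nat) (N / p)).
  - induction N as [|N IH].
    + cbn [sum_f_R0]. rewrite Nat.Div0.mod_0_l, Nat.Div0.div_0_l. cbn [sum_f_R0].
      rewrite Nat.mul_0_r. destruct (Nat.eq_dec 0 0); [lra|lia].
    + cbn [sum_f_R0]. destruct (Nat.eq_dec (S N mod p) 0) as [E|E].
      * pose proof (Nat.div_mod_eq (S N) p). pose proof (Nat.div_mod_eq N p).
        pose proof (Nat.mod_upper_bound N p ltac:(lia)).
        assert (E' : (S N / p)%nat = S (N / p)) by nia.
        rewrite E'. cbn [sum_f_R0]. replace (p * S (N / p))%nat with (S N) by nia. lra.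
      * assert (N / p <= S N / p)%nat by (apply Nat.Div0.div_le_mono; lia).
        pose proof (Hmono _ _ H). lra.
  - apply Hmono. apply Nat.Div0.div_le_upper_bound. nia.
Qed.

(** One factor of the Euler product, truncated at [N]. If [p = m + 1] is prime, a [p]-smooth number
    is either [m]-smooth or [p k] with [k] again [p]-smooth, and the second kind contributes at most
    [1/p] of the whole sum. Otherwise passing from [m] to [m + 1] admits no new prime. *)
Lemma smooth_sum_succ (m N : nat) :
  smooth_sum (S m) N * (1 - indicator primeb (S m) / INR (S m)) <= smooth_sum m N.
Proof.
  assert (HS : 0 < INR (S m)) by (apply lt_0_INR; lia).
  unfold indicator, primeb. destruct (prime_dec (Z.of_nat (S m))) as [Hp|Hp].
  - set (p := S m) in *.
    assert (H : smooth_sum p N <= smooth_sum m N + / INR p * smooth_sum p N); [|unfold Rdiv; lra].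
    apply Rle_trans with (smooth_sum m N + sum_f_R0 (fun n =>
      if Nat.eq_dec (n mod p) 0 then smooth_ind p n * / INR n else 0) N).
    + unfold smooth_sum. rewrite <- sum_plus. apply sum_Rle. intros n _.
      pose proof (inv_INR_nonneg n). pose proof (smooth_ind_bounds m n).
      assert (0 <= smooth_ind m n * / INR n) by (apply Rmult_le_pos; lra).
      destruct (Nat.eq_dec (n mod p) 0) as [E|E]; [lra|].
      rewrite Rplus_0_r. apply Rmult_le_compat_r; auto.
      unfold smooth_ind. destruct (excluded_middle_informative (smooth p n)) as [Hn|],
        (excluded_middle_informative (smooth m n)) as [|Hn']; try lra.
      exfalso. apply Hn'. intros q Hq Hqn. pose proof (Hn q Hq Hqn).
      assert (q <> Z.of_nat p); [|lia]. intros ->. apply E.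
      apply Nat.Lcm0.mod_divide. destruct Hqn as [k Hk]. exists (Z.to_nat k). nia.
    + apply Rplus_le_compat_l.
      eapply Rle_trans; [apply (sum_multiples_le (fun n => smooth_ind p n * / INR n))|].
      * unfold p; lia.
      * intros n. apply Rmult_le_pos; [apply smooth_ind_bounds|apply inv_INR_nonneg].
      * unfold smooth_sum. rewrite scal_sum. apply sum_Rle. intros k _.
        rewrite mult_INR, Rinv_mult.
        assert (Hle : smooth_ind p (p * k) <= smooth_ind p k).
        { unfold smooth_ind. destruct (excluded_middle_informative (smooth p (p * k))) as [Hn|],
            (excluded_middle_informative (smooth p k)) as [|Hn']; try lra.
          exfalso. apply Hn'. intros q Hq Hqk. apply Hn; auto.
          rewrite Nat2Z.inj_mul. now apply Z.divide_mul_r. }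
        pose proof (inv_INR_nonneg k). pose proof (inv_INR_nonneg p).
        assert (0 <= / INR p * / INR k) by now apply Rmult_le_pos. nra.
  - unfold Rdiv. rewrite Rmult_0_l, Rminus_0_r, Rmult_1_r. unfold smooth_sum.
    apply sum_Rle. intros n _. apply Rmult_le_compat_r; [apply inv_INR_nonneg|].
    unfold smooth_ind. destruct (excluded_middle_informative (smooth (S m) n)) as [Hn|],
      (excluded_middle_informative (smooth m n)) as [|Hn']; try lra.
    exfalso. apply Hn'. intros q Hq Hqn. pose proof (Hn q Hq Hqn).
    assert (q <> Z.of_nat (S m)); [|lia]. now intros ->.
Qed.

(** With [t = 1/p] this bounds the Euler factor [1 / (1 - 1/p)] by [exp (2/p)]; it rests on
    [(1 + 2 t) (1 - t) >= 1] for [0 <= t <= 1/2]. *)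
Lemma inv_le_exp (t : R) : 0 <= t <= / 2 -> 1 <= exp (2 * t) * (1 - t).
Proof.
  intros Ht. apply Rle_trans with ((1 + 2 * t) * (1 - t)); [nra|].
  apply Rmult_le_compat_r; [lra|].
  destruct (Req_dec t 0) as [->|]; [rewrite !Rmult_0_r, exp_0; lra|].
  left. apply exp_ineq1. lra.
Qed.

Lemma smooth_sum_le_exp (m N : nat) :
  smooth_sum (S m) N <= exp (2 * sum_f_R0 (fun i => indicator primeb (S i) / INR (S i)) m).
Proof.
  assert (Hstep : forall k, smooth_sum (S k) N <=
    exp (2 * (indicator primeb (S k) / INR (S k))) * smooth_sum k N).
  { intros k. set (t := indicator primeb (S k) / INR (S k)).
    assert (Ht : 0 <= t <= / 2).
    { unfold t, indicator, primeb. destruct (prime_dec (Z.of_nat (S k))) as [Hp|].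
      - apply prime_ge_2 in Hp. assert (2 <= INR (S k)) by (apply (le_INR 2); lia).
        split; [apply Rdiv_le_0_compat; lra|]. unfold Rdiv. rewrite Rmult_1_l.
        apply Rinv_le_contravar; lra.
      - unfold Rdiv. lra. }
    pose proof (inv_le_exp t Ht). pose proof (smooth_sum_succ k N) as H'. fold t in H'.
    assert (0 <= smooth_sum (S k) N).
    { apply cond_pos_sum. intros n.
      apply Rmult_le_pos; [apply smooth_ind_bounds|apply inv_INR_nonneg]. }
    pose proof (exp_pos (2 * t)).
    apply Rle_trans with (exp (2 * t) * (smooth_sum (S k) N * (1 - t))); [nra|].
    apply Rmult_le_compat_l; lra. }
  induction m as [|m IH]; cbn [sum_f_R0].
  - eapply Rle_trans; [apply Hstep|]. rewrite <- (Rmult_1_r (exp _)) at 2.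
    apply Rmult_le_compat_l; [left; apply exp_pos|apply smooth_sum_zero].
  - eapply Rle_trans; [apply Hstep|]. rewrite Rmult_plus_distr_l, Rplus_comm, exp_plus.
    apply Rmult_le_compat_l; [left; apply exp_pos|apply IH].
Qed.

Lemma prime_reciprocals_diverge (C : R) :
  exists N, C < sum_f_R0 (fun i => indicator primeb (S i) / INR (S i)) N.
Proof.
  destruct (harmonic_unbounded (exp (2 * C))) as [N HN]. exists N.
  pose proof (smooth_sum_le_exp N (S N)) as H.
  (* Every positive [n <= N + 1] is [(N + 1)]-smooth, so the smooth sum contains the whole harmonic
     sum. *)
  assert (harmonic N <= smooth_sum (S N) (S N)).
  { unfold smooth_sum. rewrite decomp_sum by lia. simpl pred.
    simpl (INR 0). rewrite Rinv_0, Rmult_0_r, Rplus_0_l.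
    apply sum_Rle. intros n Hn. unfold smooth_ind.
    destruct excluded_middle_informative as [|Hsm]; [lra|].
    exfalso. apply Hsm. intros q Hq Hqn. apply Z.divide_pos_le in Hqn; lia. }
  assert (exp (2 * C) < exp (2 * sum_f_R0 (fun i => indicator primeb (S i) / INR (S i)) N)) by lra.
  apply exp_lt_inv in H1. lra.
Qed.

Theorem theorem2p5 (alpha : R) (Halpha : 0 < alpha < 1) :
  massive (P_alpha alpha) primeb.
Proof.
  apply massive_of_divergent_reciprocals; auto.
  - intros z. unfold primeb. destruct (prime_dec z) as [Hp|]; [|discriminate].
    intros _. apply prime_ge_2 in Hp. lia.
  - apply prime_reciprocals_diverge.
Qed.
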